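(* Let $u:\Gamma\to\mathbb{R}$ be the value function of the control problem on $\Gamma$, $$u(\mathbf{x})=\inf_{\mathbf{a}(\cdot)\in\mathcal{A}_\mathbf{x}}C(\mathbf{x},\mathbf{a}(\cdot)),$$ and let $v:T_\epsilon\to\mathbb{R}$ be the value function of the extended control problem on $T_\epsilon$, $$v(\mathbf{z})=\inf_{\mathbf{a}(\cdot)\in\mathcal{A}_\mathbf{z}}\overline C(\mathbf{z},\mathbf{a}(\cdot)).$$ Then $v$ is the constant normal extension of $u$: $v(\mathbf{z})=u(P_\Gamma\mathbf{z})$ for all $\mathbf{z}\in T_\epsilon$.
   Context: Geometry. Let $n\in\{2,3\}$, let $\Omega\subset\mathbb{R}^n$ be a bounded connected open set with smooth closed boundary $\Gamma=\partial\Omega$. For $\epsilon>0$ let $T_\epsilon=\{\mathbf{z}\in\mathbb{R}^n:\min_{\mathbf{x}\in\Gamma}\|\mathbf{x}-\mathbf{z}\|<\epsilon\}$. Throughout, $\epsilon$ is small enough (smaller than the reach of $\Gamma$) that the closest point map $P_\Gamma:T_\epsilon\to\Gamma$, $P_\Gamma(\mathbf{z})=\arg\min_{\mathbf{y}\in\Gamma}\|\mathbf{z}-\mathbf{y}\|$, is well defined and differentiable. Let $d_\Gamma$ be the signed distance to $\Gamma$ on $T_\epsilon$ (negative in $\Omega$, positive outside $\overline\Omega$), and for $|\eta|<\epsilon$ let $\Gamma_\eta=\{\mathbf{z}\in T_\epsilon: d_\Gamma(\mathbf{z})=\eta\}$ be the parallel surface. The tangent plane of $\Gamma_\eta$ at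 $\mathbf{z}\in\Gamma_\eta$ coincides with $T_{P_\Gamma\mathbf{z}}\Gamma$ (as linear subspaces of $\mathbb{R}^n$). The tensor $B$. For $\mathbf{z}\in T_\epsilon$ with $\eta=d_\Gamma(\mathbf{z})$, let $\mathbf{t}_1,\mathbf{t}_2$ be orthonormal tangent vectors in the principal curvature directions of $\Gamma_\eta$ at $\mathbf{z}$, $\mathbf{n}$ the unit normal to $\Gamma_\eta$ at $\mathbf{z}$, and $\sigma_1,\sigma_2$ the singular values of the Jacobian $P_\Gamma'(\mathbf{z})$ associated with $\mathbf{t}_1,\mathbf{t}_2$, i.e. $P_\Gamma'(\mathbf{z})=\sigma_1\mathbf{t}_1\otimes\mathbf{t}_1+\sigma_2\mathbf{t}_2\otimes\mathbf{t}_2$ (with $\sigma_i=1-d_\Gamma(\mathbf{z})\kappa_i(\mathbf{z})>0$, $\kappa_i$ the principal curvatures of $\Gamma_\eta$ at $\mathbf{z}$). For a fixed real number $\mu$, $$B(\mathbf{z},\mu)=\sigma_1^{-1}\mathbf{t}_1\otimes\mathbf{t}_1+\sigma_2^{-1}\mathbf{t}_2\otimes\mathbf{t}_2+\mu\,\mathbf{n}\otimes\mathbf{n}$$ (for $n=2$ there is only $\mathbf{t}_1,\sigma_1$, and the $\mathbf{t}_2$ term is absent). Controls. For $\mathbf{x}\in\Gamma$ let $A_\mathbf{x}=S^{n-1}\cap T_\mathbf{x}\Gamma$; for $\mathbf{z}\in T_\epsilon$ let $A_\mathbf{z}:=A_{P_\Gamma\mathbf{z}}$. Let $A=\bigcup_{\mathbf{x}\in\Gamma}A_\mathbf{x}$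 and $\mathcal{A}=\{\text{measurable } \mathbf{a}:[0,\infty)\to A\}$. Data. $\mathcal{T}\subset\Gamma$ is a closed target set; $f,r:\Gamma\times A\to\mathbb{R}$ (speed and running cost) and $g:\mathcal{T}\to\mathbb{R}$ (exit penalty) satisfy: $f$ and $r$ are Lipschitz continuous in their first arguments; $g$ is lower semicontinuous with $\min_\mathcal{T}g<\infty$; there are constants with $0<R_1\le r(\mathbf{x},\mathbf{a})\le R_2$ and $0<F_1\le f(\mathbf{x},\mathbf{a})\le F_2$ for all $\mathbf{x}\in\Gamma$, $\mathbf{a}\in A$. Problem on $\Gamma$. For $\mathbf{x}\in\Gamma$ and a control $\mathbf{a}$, let $\mathbf{y}_\mathbf{x}$ solve $\frac{d\mathbf{y}}{dt}(t)=f(\mathbf{y}(t),\mathbf{a}(t))\mathbf{a}(t)$, $t>0$, $\mathbf{y}(0)=\mathbf{x}$; $\mathcal{A}_\mathbf{x}$ is the set of $\mathbf{a}(\cdot)\in\mathcal{A}$ with $\mathbf{a}(t)\in A_{\mathbf{y}_\mathbf{x}(t)}$ for all $t\ge0$ (so $\mathbf{y}_\mathbf{x}(t)\in\Gamma$ for all $t\geq 0$). The cost is $C(\mathbf{x},\mathbf{a}(\cdot))=\int_0^T r(\mathbf{y}_\mathbf{x}(t),\mathbf{a}(t))\,dt+g(\mathbf{y}_\mathbf{x}(T))$, $T=\min\{t:\mathbf{y}_\mathbf{x}(t)\in\mathcal{T}\}$. Extended problem on $T_\epsilon$. Set $\overline f(\mathbf{z},\mathbf{a})=f(P_\Gamma\mathbf{z},\mathbf{a})$,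 $\overline r(\mathbf{z},\mathbf{a})=r(P_\Gamma\mathbf{z},\mathbf{a})$, $\overline{\mathcal{T}}=\{\mathbf{z}\in T_\epsilon:P_\Gamma\mathbf{z}\in\mathcal{T}\}$, $\overline g(\mathbf{z})=g(P_\Gamma\mathbf{z})$ for $\mathbf{z}\in\overline{\mathcal{T}}$. For $\mathbf{z}\in T_\epsilon$, let $\mathbf{y}_\mathbf{z}$ solve $\frac{d\mathbf{y}}{dt}(t)=\overline f(\mathbf{y}(t),\mathbf{a}(t))B(\mathbf{y}(t),\mu)\mathbf{a}(t)$, $t>0$, $\mathbf{y}(0)=\mathbf{z}$; $\mathcal{A}_\mathbf{z}$ is the set of $\mathbf{a}(\cdot)\in\mathcal{A}$ with $\mathbf{a}(t)\in A_{\mathbf{y}_\mathbf{z}(t)}$ for all $t\ge0$ (so $\mathbf{y}_\mathbf{z}(t)\in\Gamma_\eta$ for all $t\ge0$, $\eta=d_\Gamma(\mathbf{z})$). When $\mathbf{z}\in\Gamma$ this is the same system as on $\Gamma$, so the notation is consistent. The cost is $\overline C(\mathbf{z},\mathbf{a}(\cdot))=\int_0^{\overline T}\overline r(\mathbf{y}_\mathbf{z}(t),\mathbf{a}(t))\,dt+\overline g(\mathbf{y}_\mathbf{z}(\overline T))$, $\overline T=\min\{t:\mathbf{y}_\mathbf{z}(t)\in\overline{\mathcal{T}}\}$. Costs are $+\infty$ for controls whose path never reaches the target. Solutions of ODEs are absolutely continuous functions satisfying the equation for almost every $t$. *)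

(* Defs.v *)
From HB Require Import structures.
From mathcomp Require Import all_boot all_order all_algebra.
From mathcomp Require Import all_classical all_reals all_analysis.

Set Implicit Arguments.
Unset Strict Implicit.
Unset Printing Implicit Defensive.

Import Order.TTheory GRing.Theory Num.Theory.
Import numFieldTopology.Exports numFieldNormedType.Exports.

Local Open Scope classical_set_scope.
Local Open Scope ring_scope.

(* Vectors are rows. The norm [`|v|] of the library on ['rV[R]_n] is the sup  *)
(* norm, so the Euclidean structure is introduced separately.                 *)
Section Euclidean.
Context {R : realType} {n : nat}.
Implicit Types (u v x y z : 'rV[R]_n) (S : set 'rV[R]_n).

Definition dotp u v : R := \sum_(i < n) u ord0 i * v ord0 i.

Definition enorm u : R := Num.sqrt (dotp u u).

Definition tensor u v : 'M[R]_n := u^T *m v.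

Definition dist_to S z : R := inf [set enorm (x - z) | x in S].

Definition nearest S z : set 'rV[R]_n :=
  [set y | S y /\ forall x, S x -> enorm (z - y) <= enorm (z - x)].

Definition closest_point S z : 'rV[R]_n := get (nearest S z).

Definition reach S : \bar R :=
  ereal_sup [set rho%:E | rho in [set rho : R | 0 <= rho /\
    forall z, dist_to S z < rho -> exists! y, nearest S z y]].

(* Velocities at [x] of curves drawn on [S]; for a regular hypersurface this  *)
(* is the tangent plane, as a linear subspace.                                *)
Definition tangent S x : set 'rV[R]_n :=
  [set t | exists c : R -> 'rV[R]_n,
     [/\ c 0 = x, \forall s \near (0 : R), S (c s) & is_derive (0 : R) 1 c t]].

Definition unit_tangents S x : set 'rV[R]_n :=
  [set a | tangent S x a /\ enorm a = 1].

Definition all_unit_tangents S : set 'rV[R]_n :=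
  \bigcup_(x in S) unit_tangents S x.

End Euclidean.

Section Surfaces.
Context {R : realType} {n : nat}.
Implicit Types (x z nu : 'rV[R]_n) (Omega U : set 'rV[R]_n) (eps : R).

Definition boundary Omega : set 'rV[R]_n := closure Omega `\` Omega°.

Definition iter_derive (phi : 'rV[R]_n -> R) (vs : seq 'rV[R]_n) :
  'rV[R]_n -> R := foldr (fun v psi z => 'D_v psi z) phi vs.

(* C^infinity on the open set [U]. *)
Definition smooth_on U (phi : 'rV[R]_n -> R) : Prop :=
  forall vs z, U z -> differentiable (iter_derive phi vs) z.

Definition smooth_boundary Omega : Prop :=
  forall x, boundary Omega x ->
    exists (U : set 'rV[R]_n) (phi : 'rV[R]_n -> R),
      [/\ open U, U x, smooth_on U phi, exists v, 'D_v phi x != 0 &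
          forall z, U z -> (Omega z <-> phi z < 0) /\
                           (boundary Omega z <-> phi z = 0)].

Definition tube Omega eps : set 'rV[R]_n :=
  [set z | dist_to (boundary Omega) z < eps].

Definition signed_dist Omega z : R :=
  if z \in Omega then - dist_to (boundary Omega) z
  else dist_to (boundary Omega) z.

Definition parallel_surface Omega eps (eta : R) : set 'rV[R]_n :=
  [set z | tube Omega eps z /\ signed_dist Omega z = eta].

(* [nu] is the unit normal at [z] to the parallel surface through [z], on the *)
(* side where the signed distance increases.                                  *)
Definition outer_normal Omega eps z nu : Prop :=
  [/\ enorm nu = 1,
      forall t, tangent (parallel_surface Omega eps (signed_dist Omega z)) z t ->
        dotp nu t = 0 &
      \forall s \near (0 : R)^'+, signed_dist Omega z < signed_dist Omega (z + s *: nu)].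

(* The data at [z] entering the tensor B, the surface under consideration     *)
(* being the parallel surface through [z]. The principal directions [t i] are *)
(* the eigenvectors, and the principal curvatures [kappa i] the eigenvalues,  *)
(* of the differential of the outer normal field [nu] along that surface: the *)
(* curvatures of a sphere bounding a ball are positive, which is the sign     *)
(* convention under which [sigma i = 1 - d * kappa i]. There are [n.-1] of    *)
(* them.                                                                      *)
Definition principal_frame Omega eps (nu : 'rV[R]_n -> 'rV[R]_n) z
    (t : 'I_n.-1 -> 'rV[R]_n) (kappa sigma : 'I_n.-1 -> R) : Prop :=
  [/\ outer_normal Omega eps z (nu z),
      forall i, tangent (parallel_surface Omega eps (signed_dist Omega z)) z (t i),
      forall i j, dotp (t i) (t j) = (i == j)%:R &
      forall i, is_derive z (t i) nu (kappa i *: t i)] /\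
  [/\ 'J (closest_point (boundary Omega)) z =
        \sum_(i < n.-1) sigma i *: tensor (t i) (t i),
      forall i, sigma i = 1 - signed_dist Omega z * kappa i &
      forall i, 0 < sigma i].

Definition Btensor (t : 'I_n.-1 -> 'rV[R]_n) (sigma : 'I_n.-1 -> R) nu (mu : R) :
    'M[R]_n :=
  \sum_(i < n.-1) (sigma i)^-1 *: tensor (t i) (t i) + mu *: tensor nu nu.

End Surfaces.

Section Control.
Context {R : realType} {n : nat}.
Local Notation V := 'rV[R]_n.
Implicit Types (a y : R -> V) (X Tgt Gamma : set V) (x : V).

(* Absolute continuity on each compact subinterval of [0, +oo[. *)
Definition abs_continuous y : Prop :=
  forall b e : R, 0 <= b -> 0 < e -> exists2 d : R, 0 < d &
    forall (m : nat) (lo hi : 'I_m -> R),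
      (forall i, 0 <= lo i /\ lo i <= hi i /\ hi i <= b) ->
      (forall i j, i != j -> hi i <= lo j \/ hi j <= lo i) ->
      \sum_(i < m) (hi i - lo i) < d ->
      \sum_(i < m) enorm (y (hi i) - y (lo i)) < e.

(* [y] solves y' = F(y, a), y(0) = x on [0, +oo[; [X] is the domain of [F] in *)
(* its first argument. Only values at nonnegative times matter.               *)
Definition solves X (F : V -> V -> V) x a y : Prop :=
  [/\ y 0 = x, forall t, 0 <= t -> X (y t), abs_continuous y &
      {ae @lebesgue_measure R, forall t : R, 0 < t -> is_derive t (1 : R) y (F (y t) (a t))}].

(* A function into R^n is measurable iff its coordinates are. *)
Definition controls Gamma : set (R -> V) :=
  [set a : R -> V | (forall i, measurable_fun (`[0, +oo[ : set R) (fun t : R => a t ord0 i)) /\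
           forall t, 0 <= t -> all_unit_tangents Gamma (a t)].

(* Pairs of an admissible control at [x] and its path. *)
Definition admissible Gamma X F (Adm : V -> set V) x : set ((R -> V) * (R -> V)) :=
  [set ay | [/\ controls Gamma ay.1, solves X F x ay.1 ay.2 &
                forall t, 0 <= t -> Adm (ay.2 t) (ay.1 t)]].

Definition first_hit Tgt y : set R :=
  [set T | [/\ 0 <= T, Tgt (y T) & forall t, 0 <= t -> Tgt (y t) -> T <= t]].

Definition cost (r : V -> V -> R) Tgt (g : V -> R) a y : \bar R :=
  if `[< exists2 t, 0 <= t & Tgt (y t) >] then
    let T := get (first_hit Tgt y) in
    (\int[@lebesgue_measure R]_(t in `[0%R, T]) (r (y t) (a t))%:E + (g (y T))%:E)%E
  else +oo%E.

Definition surface_value Gamma (f r : V -> V -> R) Tgt (g : V -> R) x : \bar R :=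
  ereal_inf [set cost r Tgt g ay.1 ay.2 | ay in
    admissible Gamma Gamma (fun x a : V => f x a *: a) (unit_tangents Gamma) x].

(* [B z] is symmetric, so [a *m B z] is B(z) applied to [a]. *)
Definition extended_value Gamma Teps (B : V -> 'M[R]_n)
    (f r : V -> V -> R) Tgt (g : V -> R) (z : V) : \bar R :=
  let P := closest_point Gamma in
  ereal_inf
    [set cost (fun x (a : V) => r (P x) a) [set x | Teps x /\ Tgt (P x)] (g \o P) ay.1 ay.2
     | ay in admissible Gamma Teps (fun x a : V => f (P x) a *: (a *m B x))
               (fun x => unit_tangents Gamma (P x)) z].

End Control.

(* Main.v *)
(* Both problems have the same set of costs, control by control. If y is an    *)
(* extended path, then P o y solves the problem on the surface, since the      *)
(* Jacobian of P inverts B on tangent vectors. Conversely, a surface path x    *)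
(* lifts to y = x + eta nu(x), with eta = (z - P z) . nu(P z), and             *)
(* differentiating P(y) = x gives y' = f B(y) a.                               *)
(*                                                                            *)
(* Absolute continuity requires P and the lifting to be Lipschitz, whereas P   *)
(* is only assumed to be differentiable. Uniqueness of projections implies     *)
(* that the distance to the surface grows linearly along each normal ray until *)
(* it reaches eps. Hence every surface point is touched from both sides by     *)
(* balls of any radius s < eps not meeting the surface. That the surface lies  *)
(* outside these balls bounds the Lipschitz constant of P (Federer); that the  *)
(* inner balls lie in Omega and the outer ones do not makes them disjoint,     *)
(* which gives |nu a - nu b| <= |a - b| / s.                                   *)

Require Import Defs.
From HB Require Import structures.
From mathcomp Require Import all_boot all_order all_algebra.
From mathcomp Require Import all_classical all_reals all_analysis.
From mathcomp Require Import ring lra.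

Import Order.TTheory GRing.Theory Num.Theory.
Import numFieldTopology.Exports numFieldNormedType.Exports.

Local Open Scope classical_set_scope.
Local Open Scope ring_scope.

Set Implicit Arguments.
Unset Strict Implicit.
Unset Printing Implicit Defensive.

(** The path correspondences are [admissible_projection] and [admissible_offset]. The extended data
    depend on a point only through its projection, so [cost_transfer] equates the costs and both
    infima run over one set.

    The algebra: by [normal_foot] the normals at z and at [P] z agree up to sign, so an admissible
    direction at z is orthogonal to [nu] z, and on such directions the Jacobian of [P] undoes B
    ([Btensor_jacobian]).

    The regularity comes from metric geometry. [dist_to_ray] prolongs projection rays to every
    length below [eps]. The balls this keeps free of the surface give [closest_point_lipschitz] and,
    through [dist_to_normal], touching balls on both sides of each boundary point.
    [opposite_balls_disjoint] turns these into [normal_lipschitz], hence a Lipschitz lifting. In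
    [is_derive_offset] the same bound makes the normal part of the lifted increment negligible to
    first order, while the rest is recovered from the differentiability of [P]. *)

Section EuclideanNorm.
Context {R : realType} {n : nat}.
Implicit Types (u v w : 'rV[R]_n) (k e : R).

(** * The Euclidean norm and its comparison with the sup norm *)

Lemma dotpC u v : dotp u v = dotp v u.
Proof. by apply: eq_bigr => i _; rewrite mulrC. Qed.

Lemma dotpDl u v w : dotp (u + v) w = dotp u w + dotp v w.
Proof. by rewrite -big_split; apply: eq_bigr => i _; rewrite mxE mulrDl. Qed.

Lemma dotpZl k u v : dotp (k *: u) v = k * dotp u v.
Proof. by rewrite /dotp mulr_sumr; apply: eq_bigr => i _; rewrite mxE mulrA. Qed.

Lemma dotpNl u v : dotp (- u) v = - dotp u v.
Proof. by rewrite -scaleN1r dotpZl mulN1r. Qed.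

Lemma dotpDr u v w : dotp w (u + v) = dotp w u + dotp w v.
Proof. by rewrite dotpC dotpDl !(dotpC w). Qed.

Lemma dotpZr k u v : dotp u (k *: v) = k * dotp u v.
Proof. by rewrite dotpC dotpZl dotpC. Qed.

Lemma dotpNr u v : dotp u (- v) = - dotp u v.
Proof. by rewrite dotpC dotpNl dotpC. Qed.

Definition dotpE := (dotpDl, dotpDr, dotpNl, dotpNr, dotpZl, dotpZr).

Lemma dotp0l u : dotp 0 u = 0.
Proof. by rewrite -(scale0r 0) dotpZl mul0r. Qed.

Lemma dotpp_ge0 u : 0 <= dotp u u.
Proof. by apply: sumr_ge0 => i _; rewrite -expr2 sqr_ge0. Qed.

Lemma dotpp_eq0 u : dotp u u = 0 -> u = 0.
Proof.
move=> u0; apply/rowP => i; rewrite mxE.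
have /psumr_eq0P : forall i : 'I_n, true -> 0 <= u ord0 i * u ord0 i.
  by move=> j _; rewrite -expr2 sqr_ge0.
by move=> /(_ u0) /(_ i isT) /eqP; rewrite mulf_eq0 orbb => /eqP.
Qed.

Lemma enorm_ge0 u : 0 <= enorm u.
Proof. exact: sqrtr_ge0. Qed.

Lemma enorm_sqr u : enorm u ^+ 2 = dotp u u.
Proof. by rewrite sqr_sqrtr // dotpp_ge0. Qed.

Lemma enorm0 : enorm (0 : 'rV[R]_n) = 0.
Proof. by rewrite /enorm dotp0l sqrtr0. Qed.

Lemma enorm_eq0 u : enorm u = 0 -> u = 0.
Proof. by move=> u0; apply: dotpp_eq0; rewrite -enorm_sqr u0 expr0n. Qed.

Lemma enormZ k u : enorm (k *: u) = `|k| * enorm u.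
Proof.
by rewrite /enorm dotpZl dotpZr mulrA -expr2 sqrtrM ?sqr_ge0// sqrtr_sqr.
Qed.

Lemma enormN u : enorm (- u) = enorm u.
Proof. by rewrite /enorm dotpNl dotpNr opprK. Qed.

Lemma enormB u v : enorm (u - v) = enorm (v - u).
Proof. by rewrite -enormN opprB. Qed.

Lemma cauchy_schwarz u v : dotp u v <= enorm u * enorm v.
Proof.
have [v0|v_neq0] := eqVneq (dotp v v) 0.
  by rewrite (dotpp_eq0 v0) enorm0 mulr0 dotpC dotp0l.
have v_gt0 : 0 < dotp v v by rewrite lt0r v_neq0 dotpp_ge0.
apply: le_trans (ler_norm _) _.
rewrite -(ler_pXn2r (n := 2)) ?nnegrE ?mulr_ge0 ?enorm_ge0//.
rewrite exprMn !enorm_sqr real_normK ?num_real//.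
have := dotpp_ge0 (dotp v v *: u - dotp u v *: v).
rewrite !dotpE (dotpC v u) => sq_ge0.
rewrite -(ler_pM2l v_gt0); lra.
Qed.

Lemma cauchy_schwarz_norm u v : `|dotp u v| <= enorm u * enorm v.
Proof.
rewrite ler_norml cauchy_schwarz andbT lerNl -dotpNl -(enormN u).
exact: cauchy_schwarz.
Qed.

Lemma ler_enorm_sqr u k : 0 <= k -> (enorm u <= k) = (dotp u u <= k ^+ 2).
Proof.
by move=> k0; rewrite -enorm_sqr ler_pXn2r// nnegrE enorm_ge0.
Qed.

Lemma ger_enorm_sqr u k : 0 <= k -> (k <= enorm u) = (k ^+ 2 <= dotp u u).
Proof.
by move=> k0; rewrite -enorm_sqr ler_pXn2r// nnegrE enorm_ge0.
Qed.

Lemma ler_enormD u v : enorm (u + v) <= enorm u + enorm v.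
Proof.
rewrite ler_enorm_sqr ?addr_ge0 ?enorm_ge0// !dotpE (dotpC v u) sqrrD !enorm_sqr.
have := cauchy_schwarz u v; set a := _ * _; lra.
Qed.

Lemma ler_enormB u v : enorm (u - v) <= enorm u + enorm v.
Proof. by rewrite -(enormN v) ler_enormD. Qed.

Lemma ler_enorm_distD w u v : enorm (u - v) <= enorm (u - w) + enorm (w - v).
Proof. by rewrite (le_trans _ (ler_enormD _ _))// addrA subrK. Qed.

Lemma mx_norm_le_enorm u : `|u| <= enorm u.
Proof.
rewrite [leLHS]/Num.norm /= mx_normrE; apply/bigmax_leP; split=> [|[i j] _] /=.
  exact: enorm_ge0.
rewrite (ord1 i) -(ler_pXn2r (n := 2)) ?nnegrE ?enorm_ge0//.
rewrite enorm_sqr real_normK ?num_real// /dotp (bigD1 j)//= -expr2 lerDl.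
by apply: sumr_ge0 => k _; rewrite -expr2 sqr_ge0.
Qed.

Lemma coord_le_mx_norm u i : `|u ord0 i| <= `|u|.
Proof.
rewrite [leRHS]/Num.norm /= mx_normrE; apply/bigmax_geP; right => /=.
by exists (ord0, i).
Qed.

Lemma enorm_le_mx_norm u : enorm u <= n.+1%:R * `|u|.
Proof.
rewrite ler_enorm_sqr ?mulr_ge0// exprMn.
apply: (@le_trans _ _ (\sum_(i < n) `|u| ^+ 2)).
  apply: ler_sum => i _; rewrite -expr2 -(real_normK (num_real (u ord0 i))).
  by rewrite ler_pXn2r ?nnegrE// coord_le_mx_norm.
rewrite sumr_const card_ord -[leLHS]mulr_natl ler_wpM2r ?sqr_ge0//.
by rewrite -natrX ler_nat -[leqLHS]muln1 -mulnn leq_mul.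
Qed.

(** The topology is that of the sup norm; equivalence of norms allows all later estimates to be
    Euclidean. *)
Lemma nbhs_enormP (A : set 'rV[R]_n) v :
  nbhs v A <-> exists2 d, 0 < d & forall w, enorm (w - v) < d -> A w.
Proof.
split=> [/nbhs_ballP [d /= d0 vA]|[d d0 vA]].
  exists d => // w wd; apply: vA; rewrite -ball_normE /= distrC.
  exact: le_lt_trans (mx_norm_le_enorm _) wd.
apply/nbhs_ballP; exists (d / n.+1%:R) => /=; first by rewrite divr_gt0.
move=> w; rewrite -ball_normE /= distrC ltr_pdivlMr// mulrC => wd.
by apply: vA; exact: le_lt_trans (enorm_le_mx_norm _) wd.
Qed.

End EuclideanNorm.

(** * Differentiability as first-order Euclidean estimates *)

Section EuclideanDifferentiation.
Context {R : realType} {n : nat}.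
Implicit Types (c : R -> 'rV[R]_n) (u v z : 'rV[R]_n).

Lemma littleo_enorm (W : normedModType R) (F : 'rV[R]_n -> W) z :
  differentiable F z -> forall e : R, 0 < e -> exists2 d : R, 0 < d &
    forall w, enorm w < d -> `|F (z + w) - F z - 'd F z w| <= e * enorm w.
Proof.
move=> dF e e0; have := diff_locallyxC dF; set o := the_littleo _ _ _ _ _ => oE.
have := littleoP [littleo of o] => /(_ e e0) /= /nbhs_enormP[d d0 od].
exists d => // w wd; rewrite oE -[X in `|X|]addrA -opprD addrAC subrr add0r.
apply: le_trans (od w _) _; first by rewrite subr0.
by rewrite ler_pM2l// mx_norm_le_enorm.
Qed.

Lemma differentiable_enorm (F : 'rV[R]_n -> 'rV[R]_n) z : differentiable F z ->
  forall e : R, 0 < e -> exists2 d : R, 0 < d &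
    forall w, enorm w < d -> enorm (F (z + w) - F z - w *m 'J F z) <= e * enorm w.
Proof.
move=> dF e e0.
have [|d d0 dP] := @littleo_enorm _ F z dF (e / n.+1%:R); first by rewrite divr_gt0.
exists d => // w /dP; rewrite /jacobian mul_rV_lin1 => ?.
apply: le_trans (enorm_le_mx_norm _) _.
by rewrite -ler_pdivlMl// mulrA (mulrC _ e).
Qed.

Lemma is_derive_enormP c t v : is_derive t (1 : R) c v <->
  forall e : R, 0 < e -> exists2 d : R, 0 < d &
    forall h, `|h| < d -> enorm (c (t + h) - c t - h *: v) <= e * `|h|.
Proof.
split=> [[dc <-] e e0|H].
  have := dc; rewrite /derivable -/(derive c t 1) => /cvgrPdist_le.
  rewrite -/(derive c t 1) => /(_ (e / n.+1%:R)).
  rewrite divr_gt0// => /(_ isT) /nbhs_ballP [d /= d0 dP]; exists d => // h hd.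
  have [->|h0] := eqVneq h 0.
    by rewrite addr0 subrr scale0r subr0 enorm0 normr0 mulr0.
  have := dP h; rewrite -ball_normE /= sub0r normrN => /(_ hd h0).
  rewrite -[_%:A]/(h * 1) mulr1 (addrC h) => hle.
  apply: le_trans (enorm_le_mx_norm _) _.
  rewrite -ler_pdivlMl// mulrA (mulrC _ e) -ler_pdivrMr ?normr_gt0//.
  apply: le_trans hle; rewrite -normfV mulrC -normrZ -normrN.
  by rewrite scalerBr scalerA mulVf// scale1r opprB.
have cv : h^-1 *: ((c \o shift t) (h *: (1 : R)) - c t) @[h --> 0^'] --> v.
  apply/cvgrPdist_le => e e0; have [d d0 dP] := H e e0.
  apply/nbhs_ballP; exists d => //= h; rewrite -ball_normE /= sub0r normrN => hd h0.
  rewrite -[_%:A]/(h * 1) mulr1 (addrC h).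
  rewrite -(ler_pM2l (x := `|h|)) ?normr_gt0//.
  rewrite -normrZ -normrN scalerBr scalerA mulfV// scale1r opprB mulrC.
  exact: le_trans (mx_norm_le_enorm _) (dP _ hd).
by apply: DeriveDef; [apply/cvg_ex; exists v|exact: cvg_lim].
Qed.

End EuclideanDifferentiation.

(** * The distance to a set *)

Lemma enorm_lipschitz_continuous {R : realType} {n : nat} (f : 'rV[R]_n -> R) :
  (forall z w, f z <= f w + enorm (z - w)) -> continuous f.
Proof.
move=> fL z; apply/(@cvgrPdist_lt _ _ _ _ (nbhs_filter z)) => e e0.
apply/nbhs_enormP; exists e => // w wz; apply: le_lt_trans wz.
rewrite ler_norml; apply/andP; split; first by have := fL w z; lra.
by have := fL z w; rewrite (enormB z); lra.
Qed.

Lemma continuous_enormB {R : realType} {n : nat} (z : 'rV[R]_n) :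
  continuous (fun x : 'rV[R]_n => enorm (x - z)).
Proof.
apply: enorm_lipschitz_continuous => x y.
by rewrite [leRHS]addrC; exact: ler_enorm_distD.
Qed.

Section Distance.
Context {R : realType} {n : nat} (S : set 'rV[R]_n).
Hypothesis S_neq0 : S !=set0.
Implicit Types (x y z v w : 'rV[R]_n) (k e : R).

Lemma dist_to_le x z : S x -> dist_to S z <= enorm (z - x).
Proof.
move=> Sx; apply: ge_inf; last by exists x => //; rewrite enormB.
by exists 0 => _ [y _ <-]; exact: enorm_ge0.
Qed.

Lemma dist_to_ge z k : (forall x, S x -> k <= enorm (z - x)) -> k <= dist_to S z.
Proof.
move=> Hk; apply: lb_le_inf.
  by have [x Sx] := S_neq0; exists (enorm (x - z)); exists x.
by move=> _ [y Sy <-]; rewrite enormB; exact: Hk.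
Qed.

Lemma dist_to_ge0 z : 0 <= dist_to S z.
Proof. by apply: dist_to_ge => x _; exact: enorm_ge0. Qed.

Lemma dist_to_lipschitz z w : dist_to S z <= dist_to S w + enorm (z - w).
Proof.
rewrite -lerBlDr; apply: dist_to_ge => x Sx; rewrite lerBlDr addrC.
exact: le_trans (dist_to_le _ Sx) (ler_enorm_distD _ _ _).
Qed.

Lemma dist_to_eq0 x : S x -> dist_to S x = 0.
Proof.
move=> Sx; apply/eqP; rewrite eq_le dist_to_ge0 andbT.
by have := dist_to_le x Sx; rewrite subrr enorm0.
Qed.

Lemma nearestP z y : nearest S z y <-> S y /\ enorm (z - y) = dist_to S z.
Proof.
split=> [[Sy zy]|[Sy zy]]; split => //.
  by apply/eqP; rewrite eq_le dist_to_ge// dist_to_le.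
by move=> x Sx; rewrite zy; exact: dist_to_le.
Qed.

Lemma continuous_dist_to : continuous (dist_to S).
Proof. exact: enorm_lipschitz_continuous dist_to_lipschitz. Qed.

End Distance.

Lemma compact_enorm_ball {R : realType} {n : nat} (z : 'rV[R]_n) (k : R) :
  compact [set x | enorm (x - z) <= k].
Proof.
apply: bounded_closed_compact.
  exists (k + enorm z); split; first exact: num_real.
  move=> M kM x /= xz; apply: le_trans (ltW kM).
  apply: le_trans (mx_norm_le_enorm _) _; rewrite -[x](subrK z).
  by rewrite (le_trans (ler_enormD _ _))// lerD2r.
have -> : [set x | enorm (x - z) <= k] = (fun x => enorm (x - z)) @^-1` [set t | t <= k].
  by [].
have /continuous_closedP := @continuous_enormB R n z.
by apply; exact: closed_le.
Qed.

(** * Sets with unique projection: projection rays and the Lipschitz bound *)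

Section UniqueProjection.
Context {R : realType} {n : nat} (S : set 'rV[R]_n) (eps : R).
Hypothesis S_neq0 : S !=set0.
Hypothesis unique_nearest :
  forall z, dist_to S z < eps -> exists! y, nearest S z y.
Let P := closest_point S.
Hypothesis P_continuous : forall z, dist_to S z < eps -> {for z, continuous P}.
Implicit Types (a b x y z v w : 'rV[R]_n) (k e s m : R).

Lemma closest_point_nearest z : dist_to S z < eps -> nearest S z (P z).
Proof. by move=> /unique_nearest [y [zy _]]; apply: getI zy. Qed.

Lemma closest_point_in z : dist_to S z < eps -> S (P z).
Proof. by move=> /closest_point_nearest []. Qed.

Lemma enorm_closest_point z : dist_to S z < eps -> enorm (z - P z) = dist_to S z.
Proof. by move=> /closest_point_nearest /(nearestP S_neq0) []. Qed.

Lemma closest_point_eq z x : S x -> enorm (z - x) = dist_to S z ->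
  dist_to S z < eps -> P z = x.
Proof.
move=> Sx zx ze; have [y [_ uy]] := unique_nearest ze.
rewrite -(uy (P z) (closest_point_nearest ze)); exact/uy/nearestP.
Qed.

Lemma closest_point_id x : 0 < eps -> S x -> P x = x.
Proof.
by move=> eps0 Sx; apply: closest_point_eq; rewrite ?subrr ?enorm0 ?dist_to_eq0.
Qed.

(** Step outwards by h along w, the unit vector from [P x] to x. By continuity the new foot q is
    close to [P x], so x - q has length at least d and inner product nearly d with w. Expanding the
    square gives growth at a rate close to 1. *)
Lemma dist_to_grows x k e : 0 < dist_to S x -> dist_to S x < eps -> k < 1 -> 0 <= k ->
  0 < e -> exists h w,
    [/\ 0 < h < e, enorm w = 1 & dist_to S x + k * h < dist_to S (x + h *: w)].
Proof.
set d := dist_to S x => d0 de k1 k0 e0.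
have c0 : 0 < (1 - k) * d / 2 by rewrite divr_gt0// mulr_gt0// subr_gt0.
have : nbhs x [set y | `|P x - P y| < (1 - k) * d / 2 / n.+1%:R].
  have /(@cvgrPdist_lt _ _ _ _ (nbhs_filter x)) := P_continuous de.
  by apply; rewrite divr_gt0.
move=> /nbhs_enormP[r r0 Pr].
pose w := d^-1 *: (x - P x).
have w1 : enorm w = 1.
  by rewrite enormZ enorm_closest_point// normfV gtr0_norm// mulVf// gt_eqF.
have xPw : x - P x = d *: w by rewrite scalerA mulfV ?gt_eqF// scale1r.
clearbody w.
pose h := Num.min (Num.min r e) (eps - d) / 2.
have hr : 0 < h /\ [/\ h < r, h < e & h < eps - d].
  have m0 : 0 < Num.min (Num.min r e) (eps - d).
    by rewrite !lt_min r0 e0 subr_gt0.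
  have [m1 m2] : Num.min (Num.min r e) (eps - d) <= eps - d /\
    Num.min (Num.min r e) (eps - d) <= Num.min r e by split; rewrite ge_min lexx ?orbT.
  have [m3 m4] : Num.min r e <= r /\ Num.min r e <= e by split; rewrite ge_min lexx ?orbT.
  rewrite /h; split; first by rewrite divr_gt0.
  by split; lra.
have [h0 [hlr hle hld]] := hr; clearbody h.
have yx : enorm (x + h *: w - x) = h.
  by rewrite addrC addKr enormZ w1 mulr1 gtr0_norm.
have ye : dist_to S (x + h *: w) < eps.
  have := dist_to_lipschitz S_neq0 (x + h *: w) x; rewrite yx -/d; lra.
exists h, w; split => //; first by rewrite h0.
have Pq : enorm (P x - P (x + h *: w)) <= (1 - k) * d / 2.
  have := Pr (x + h *: w); rewrite yx => /(_ hlr) /= /ltW.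
  by rewrite ler_pdivlMr// mulrC; exact: le_trans (enorm_le_mx_norm _).
rewrite -(ltr_pXn2r (n := 2)) ?nnegrE ?dist_to_ge0 ?addr_ge0 ?mulr_ge0 ?(ltW d0) ?(ltW h0)//.
rewrite -(enorm_closest_point ye) enorm_sqr.
set q := P (x + h *: w) in Pq *.
have -> : x + h *: w - q = (x - q) + h *: w by rewrite addrAC.
have xq : d ^+ 2 <= dotp (x - q) (x - q).
  rewrite -ger_enorm_sqr ?(ltW d0)//; exact: (dist_to_le x (closest_point_in ye)).
have wq : d - (1 - k) * d / 2 <= dotp (x - q) w.
  have -> : x - q = d *: w + (P x - q) by rewrite -xPw addrA subrK.
  rewrite dotpDl dotpZl -enorm_sqr w1 expr1n mulr1 lerD2l lerNl.
  apply: le_trans (ler_norm _) _; rewrite normrN.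
  by rewrite (le_trans (cauchy_schwarz_norm _ _))// w1 mulr1.
move: (x - q) xq wq => u xq wq.
rewrite !dotpE (dotpC w) -(enorm_sqr w) w1.
move: xq wq; set X := dotp _ _; set Y := dotp _ _ => xq wq.
have hY : h * (d - (1 - k) * d / 2) <= h * Y by rewrite ler_pM2l.
have : 0 < h * ((1 - k) * d).
  by apply: mulr_gt0 => //; apply: mulr_gt0 => //; lra.
have kh : k * h <= h by rewrite ler_piMl// ltW.
have kh0 : 0 <= k * h by rewrite mulr_ge0// ltW.
have khh : k * h * (k * h) <= h * h by rewrite ler_pM.
rewrite !expr2 in xq *; lra.
Qed.

(* Ekeland-type argument: a maximum point of the distance, penalized by        *)
(* k times the distance to z, is not interior to the ball, by [dist_to_grows]. *)
Lemma dist_to_reaches z k e : 0 < dist_to S z -> dist_to S z + e < eps ->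
  0 < e -> 0 <= k -> k < 1 ->
  exists2 x, enorm (x - z) <= e & dist_to S z + k * e <= dist_to S x.
Proof.
move=> d0 de e0 k0 k1.
pose F x := dist_to S x - k * enorm (x - z).
have Fc : continuous F.
  move=> x; apply: continuousB; first exact: continuous_dist_to.
  apply: continuousM; first exact: cst_continuous.
  exact: continuous_enormB.
have [| |x] := @EVT_max_rV R n F [set x | enorm (x - z) <= e] _ (@compact_enorm_ball R n z e).
- by exists z; rewrite /= subrr enorm0 ltW.
- exact: continuous_subspaceT.
rewrite inE /= => xz xmax; exists x => //.
have Fxz : dist_to S z <= dist_to S x - k * enorm (x - z).
  have := xmax z; rewrite inE /F /= subrr enorm0 mulr0 subr0; apply; exact: ltW.
have kx0 : 0 <= k * enorm (x - z) by rewrite mulr_ge0 ?enorm_ge0.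
have [xe|] := ltP (enorm (x - z)) e; last first.
  move=> ex; have xze : enorm (x - z) = e by apply/eqP; rewrite eq_le xz.
  by move: Fxz; rewrite xze; lra.
have xeps : dist_to S x < eps.
  have := dist_to_lipschitz S_neq0 x z; lra.
have xpos : 0 < dist_to S x by lra.
have e'0 : 0 < e - enorm (x - z) by lra.
have [h [w [/andP[h0 he] w1 dw]]] := dist_to_grows xpos xeps k1 k0 e'0.
have xwz : enorm (x + h *: w - z) <= enorm (x - z) + h.
  by rewrite addrAC (le_trans (ler_enormD _ _))// enormZ w1 mulr1 gtr0_norm.
have /xmax : x + h *: w \in [set x | enorm (x - z) <= e] by rewrite inE /=; lra.
rewrite /F; have := ler_wpM2l k0 xwz; lra.
Qed.

(** As the rate in [dist_to_reaches] tends to 1, the maximum of the distance over the ball of radius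
    s - s0 about z is seen to be at least s. A maximum point is then at least s away from a, the
    most that the triangle inequality through z allows, and equality puts it on the ray. *)
Lemma dist_to_ray a v (s s0 : R) : S a -> enorm v = 1 -> 0 < s0 -> s0 <= s -> s < eps ->
  dist_to S (a + s0 *: v) = s0 -> dist_to S (a + s *: v) = s.
Proof.
move=> Sa v1 s00; rewrite le_eqVlt => /predU1P[<-//|s0s] se ds0.
set z := a + s0 *: v in ds0.
have e0 : 0 < s - s0 by rewrite subr_gt0.
have [| |x] := @EVT_max_rV R n (dist_to S) [set x | enorm (x - z) <= s - s0] _
    (@compact_enorm_ball R n z _).
- by exists z; rewrite /= subrr enorm0 ltW.
- exact/continuous_subspaceT/continuous_dist_to.
rewrite inE /= => xz xmax.
have sx : s <= dist_to S x.
  apply/ler_addgt0Pr => t t0.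
  (* This rate loses at most t over the length s - s0; the maximum with 0 keeps it admissible when t
     is large. *)
  pose k := Num.max 0 (1 - t / (s - s0)).
  have k0 : 0 <= k by rewrite le_max lexx.
  have k1 : k < 1 by rewrite gt_max ltr01 /= gtrBl divr_gt0.
  have [|| |||y yz ydist] := @dist_to_reaches z k (s - s0); rewrite ?ds0//; first by lra.
  have /xmax xy : y \in [set x | enorm (x - z) <= s - s0] by rewrite inE.
  have : (1 - t / (s - s0)) * (s - s0) <= k * (s - s0).
    by rewrite ler_pM2r// le_max lexx orbT.
  rewrite mulrBl divfK ?gt_eqF// mul1r; move: ydist; rewrite ds0; lra.
have xa : s <= enorm (x - a) by apply: le_trans sx _; exact: dist_to_le.
suff -> : a + s *: v = x.
  apply/eqP; rewrite eq_le sx andbT.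
  have := dist_to_lipschitz S_neq0 x z; rewrite ds0; lra.
have [w xzw] : exists w, x - z = w by exists (x - z).
have xE : x - a = w + s0 *: v by rewrite -xzw /z opprD addrA subrK.
have ww : dotp w w <= (s - s0) ^+ 2 by rewrite -ler_enorm_sqr -?xzw// ltW.
have vv : dotp v v = 1 by rewrite -enorm_sqr v1 expr1n.
have wv : s - s0 <= dotp w v.
  move: xa; rewrite ger_enorm_sqr; last by lra.
  rewrite xE !dotpE vv (dotpC v w) => H.
  by rewrite -(ler_pM2l s00); move: H ww; rewrite !expr2; lra.
suff /eqP : w - (s - s0) *: v = 0.
  rewrite subr_eq0 => /eqP wE; rewrite -[RHS](subrK z) xzw wE /z addrCA -scalerDl.
  by rewrite subrK.
apply: dotpp_eq0; apply/eqP; rewrite eq_le dotpp_ge0 andbT.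
rewrite !dotpE vv (dotpC v w).
have : (s - s0) * (s - s0) <= (s - s0) * dotp w v by rewrite ler_pM2l.
move: ww; rewrite expr2; lra.
Qed.

(* Federer: z - P z makes an almost obtuse angle with b - P z, for b in S.      *)
Lemma dotp_normal_le z b m s : dist_to S z <= m -> m < s -> s < eps -> S b ->
  s * dotp (z - P z) (b - P z) <= m / 2 * dotp (b - P z) (b - P z).
Proof.
move=> zm ms seps Sb.
have ze : dist_to S z < eps by lra.
have Sa := closest_point_in ze; have za := enorm_closest_point ze.
set a := P z in Sa za *; set d := dist_to S z in zm za.
have d0 : 0 <= d := dist_to_ge0 S_neq0 z.
have bb : 0 <= dotp (b - a) (b - a) := dotpp_ge0 _.
have [d_eq0|d_neq0] := eqVneq d 0.
  have -> : z - a = 0 by apply: enorm_eq0; rewrite za.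
  by rewrite dotp0l mulr0 mulr_ge0//; lra.
have d_gt0 : 0 < d by rewrite lt0r d_neq0.
pose v := d^-1 *: (z - a).
have zav : z - a = d *: v by rewrite scalerA mulfV// scale1r.
have v1 : enorm v = 1 by rewrite enormZ za normfV gtr0_norm// mulVf.
have ds : dist_to S (a + s *: v) = s.
  apply: (dist_to_ray Sa v1 d_gt0) => //; first by lra.
  by rewrite -zav addrC subrK.
have : s <= enorm (a + s *: v - b) by rewrite -{1}ds; exact: dist_to_le.
rewrite ger_enorm_sqr; last by lra.
have -> : a + s *: v - b = s *: v - (b - a) by rewrite opprB addrCA addrA.
move: (b - a) bb => w bb.
clearbody v; rewrite zav !dotpE -(enorm_sqr v) v1 expr1n (dotpC w v) => H.
have : d * (2 * s * dotp v w) <= d * dotp w w by rewrite ler_pM2l//; lra.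
have : d * dotp w w <= m * dotp w w by rewrite ler_wpM2r.
lra.
Qed.

(** Add [dotp_normal_le] at z1, tested on the foot of z2, to the same inequality with the roles
    exchanged. The sum reads (s - m) |w|^2 <= - s (z1 - z2) . w for w the difference of the feet,
    and Cauchy-Schwarz concludes. *)
Lemma closest_point_lipschitz z1 z2 m s : dist_to S z1 <= m -> dist_to S z2 <= m ->
  m < s -> s < eps -> enorm (P z1 - P z2) <= s / (s - m) * enorm (z1 - z2).
Proof.
move=> z1m z2m ms se.
have m0 : 0 <= m := le_trans (dist_to_ge0 S_neq0 z1) z1m.
have Sa : S (P z1) by apply: closest_point_in; lra.
have Sb : S (P z2) by apply: closest_point_in; lra.
have := dotp_normal_le z1m ms se Sb; have := dotp_normal_le z2m ms se Sa.
set a := P z1; set b := P z2.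
have -> : dotp (a - b) (a - b) = dotp (b - a) (b - a).
  by rewrite -!enorm_sqr enormB.
have -> : dotp (z2 - b) (a - b) = - dotp (z2 - b) (b - a).
  by rewrite -dotpNr opprB.
set w := b - a => H1 H2; rewrite enormB -/w.
have : dotp (z1 - a) w = dotp (z1 - z2) w + dotp (z2 - b) w + dotp w w.
  by rewrite -!dotpDl !addrA subrK addrNK.
move=> E; rewrite E in H2.
have cs : - dotp (z1 - z2) w <= enorm (z1 - z2) * enorm w.
  by rewrite -dotpNl -(enormN (z1 - z2)) cauchy_schwarz.
have [w0|w_neq0] := eqVneq (enorm w) 0.
  by rewrite w0 mulr_ge0 ?enorm_ge0// divr_ge0//; lra.
have w_gt0 : 0 < enorm w by rewrite lt0r w_neq0 enorm_ge0.
rewrite mulrAC ler_pdivlMr ?subr_gt0// -(ler_pM2r w_gt0).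
have : s * - dotp (z1 - z2) w <= s * (enorm (z1 - z2) * enorm w).
  by rewrite ler_pM2l//; lra.
move: H1 H2; rewrite -enorm_sqr expr2; lra.
Qed.

End UniqueProjection.

(** * Orthonormal frames and tensors diagonal in them *)

Section OrthonormalFrame.
Context {R : realType} {n : nat}.
Implicit Types u v w : 'rV[R]_n.

Lemma mul_tensor u v w : w *m tensor u v = dotp w u *: v.
Proof.
rewrite /tensor mulmxA [w *m _]mx11_scalar mul_scalar_mx; congr (_ *: _).
by rewrite mxE; apply: eq_bigr => i _; rewrite mxE.
Qed.

Lemma mul_sum_tensor (I : finType) (s : I -> R) (t : I -> 'rV[R]_n) w :
  w *m (\sum_i s i *: tensor (t i) (t i)) = \sum_i (s i * dotp w (t i)) *: t i.
Proof.
rewrite mulmx_sumr; apply: eq_bigr => i _.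
by rewrite -scalemxAr mul_tensor scalerA.
Qed.

Lemma enorm_mulmx_bounded (M : 'M[R]_n) :
  exists2 C : R, 0 <= C & forall w, enorm (w *m M) <= C * enorm w.
Proof.
exists (n.+1%:R * \sum_j enorm (col j M)^T).
  by rewrite mulr_ge0// sumr_ge0// => j _; exact: enorm_ge0.
move=> w; apply: le_trans (enorm_le_mx_norm _) _.
rewrite -mulrA ler_pM2l// [leLHS]/Num.norm /= mx_normrE; apply/bigmax_leP; split.
  by rewrite mulr_ge0 ?enorm_ge0// sumr_ge0// => j _; exact: enorm_ge0.
move=> -[i j] _ /=; rewrite (ord1 i).
have -> : (w *m M) ord0 j = dotp w (col j M)^T.
  by rewrite mxE; apply: eq_bigr => k _; rewrite !mxE.
apply: le_trans (cauchy_schwarz_norm _ _) _.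
rewrite mulrC ler_wpM2r ?enorm_ge0// (bigD1 j)//= lerDl.
by apply: sumr_ge0 => k _; exact: enorm_ge0.
Qed.

Context (n_gt0 : (0 < n)%N) (t : 'I_n.-1 -> 'rV[R]_n) (nu : 'rV[R]_n).
Hypothesis t_orthonormal : forall i j, dotp (t i) (t j) = (i == j)%:R.
Hypothesis nu_unit : enorm nu = 1.
Hypothesis nu_orthogonal : forall i, dotp nu (t i) = 0.

(** The matrix U with rows [nu] and the [t i] is square since n > 0, so U U^T = 1 implies U^T U = 1,
    which is the claim. *)
Lemma sum_tensor_orthonormal :
  \sum_i tensor (t i) (t i) + tensor nu nu = 1%:M.
Proof.
case: n n_gt0 t nu t_orthonormal nu_unit nu_orthogonal => // m _ T N TT N1 NT.
pose U := \matrix_(k < m.+1) (if unlift ord0 k is Some i then T i else N).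
have U0 : row ord0 U = N by rewrite rowK unlift_none.
have US i : row (lift ord0 i) U = T i by rewrite rowK liftK.
have rowUU i j : (U *m U^T) i j = dotp (row i U) (row j U).
  by rewrite mxE; apply: eq_bigr => k _; rewrite !mxE.
have /mulmx1C UU : U *m U^T = 1%:M.
  apply/matrixP => i j; rewrite rowUU mxE.
  case: (unliftP ord0 i) (unliftP ord0 j) => [i'|] -> [j'|] ->; rewrite ?U0 ?US.
  - by rewrite TT (inj_eq lift_inj).
  - by rewrite dotpC NT eq_sym (negbTE (neq_lift _ _)).
  - by rewrite NT (negbTE (neq_lift _ _)).
  - by rewrite -enorm_sqr N1 expr1n eqxx.
rewrite -UU; apply/matrixP => a b; rewrite mxE addrC summxE.
have -> : (U^T *m U) a b =
    U ord0 a * U ord0 b + \sum_(i < m) U (lift ord0 i) a * U (lift ord0 i) b.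
  rewrite mxE big_ord_recl mxE; congr (_ + _).
  by apply: eq_bigr => i _; rewrite mxE.
congr (_ + _); first by rewrite !mxE big_ord1 !mxE unlift_none.
by apply: eq_bigr => i _; rewrite !mxE big_ord1 !mxE liftK.
Qed.

Lemma orthonormal_expansion w :
  w = \sum_i dotp w (t i) *: t i + dotp w nu *: nu.
Proof.
rewrite -[LHS]mulmx1 -sum_tensor_orthonormal mulmxDr mulmx_sumr mul_tensor.
by congr (_ + _); apply: eq_bigr => i _; rewrite mul_tensor.
Qed.

Lemma orthogonal_to_frame w : (forall i, dotp w (t i) = 0) -> w = dotp w nu *: nu.
Proof.
move=> wt; rewrite {1}[w]orthonormal_expansion big1 ?add0r// => i _.
by rewrite wt scale0r.
Qed.

(** For s = sigma, the second factor is B with mu = 1 and the first is the Jacobian of the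
    projection completed by the normal direction, which it kills. *)
Lemma frame_inverse (s : 'I_n.-1 -> R) : (forall i, s i != 0) ->
  (\sum_i s i *: tensor (t i) (t i) + tensor nu nu) *m
  (\sum_i (s i)^-1 *: tensor (t i) (t i) + tensor nu nu) = 1%:M.
Proof.
move=> s0; rewrite -sum_tensor_orthonormal mulmxDl; congr (_ + _); last first.
  rewrite {1}/tensor -mulmxA mulmxDr mul_sum_tensor mul_tensor -enorm_sqr nu_unit.
  rewrite expr1n scale1r big1 ?add0r// => i _.
  by rewrite nu_orthogonal mulr0 scale0r.
rewrite mulmx_suml; apply: eq_bigr => i _.
rewrite -scalemxAl {1}/tensor -mulmxA mulmxDr mul_sum_tensor mul_tensor.
rewrite (dotpC (t i)) nu_orthogonal scale0r addr0 (bigD1 i)//= big1 ?addr0.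
  by rewrite t_orthonormal eqxx mulr1 scalemxAr scalerA mulfV// scale1r.
by move=> j ji; rewrite t_orthonormal eq_sym (negbTE ji) mulr0 scale0r.
Qed.

End OrthonormalFrame.

(** * Chain rule along curves and first-order optimality of the closest point *)

Lemma is_derive_compose {R : realType} {V W : normedModType R} (c : R -> V)
    (F : V -> W) t v : is_derive t (1 : R) c v -> differentiable F (c t) ->
  is_derive t (1 : R) (F \o c) ('d F (c t) v).
Proof.
move=> [dc cv] dF; have /derivable1_diffP dc' := dc.
have dFc : differentiable (F \o c) t by exact: differentiable_comp.
apply: DeriveDef; first exact/derivable1_diffP.
by rewrite deriveE// diff_comp//= -cv deriveE.
Qed.

Lemma is_derive_compose_mx {R : realType} {n : nat} (c : R -> 'rV[R]_n)
    (F : 'rV[R]_n -> 'rV[R]_n) t v :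
  is_derive t (1 : R) c v -> differentiable F (c t) ->
  is_derive t (1 : R) (F \o c) (v *m 'J F (c t)).
Proof. by move=> dc dF; rewrite /jacobian mul_rV_lin1; exact: is_derive_compose. Qed.

(** Otherwise following the curve c for a short time of the sign of D would bring it closer to z
    than x. *)
Lemma dotp_nearest_tangent {R : realType} {n : nat} (S : set 'rV[R]_n) z x tau :
  nearest S z x -> tangent S x tau -> dotp (z - x) tau = 0.
Proof.
move=> [Sx xmin] [c [c0 cS dc]].
set D := dotp (z - x) tau; set N := enorm (z - x).
apply/eqP/negPn/negP => D0.
have Dgt0 : 0 < `|D| by rewrite normr_gt0.
have N0 : 0 <= N := enorm_ge0 _.
(* The first-order decrease of the squared distance is 2 h |D|; this e bounds the remainder term 2 N
   e h by h |D| / 2, and the later choice of h does the same for the quadratic term h^2 T^2. *)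
pose e := `|D| / (4 * (N + 1)).
have e0 : 0 < e by rewrite divr_gt0// mulr_gt0// ltr_wpDl.
have eN : e * N <= `|D| / 4.
  rewrite /e invfM mulrA mulrAC ler_pdivrMr ?ltr_wpDl//.
  by rewrite ler_pM2l ?divr_gt0// lerDl.
clearbody e.
have /is_derive_enormP/(_ e e0)[d1 d10 cd] := dc.
have /nbhs_ballP[d2 /= d20 cS2] := cS.
pose T := enorm tau + e.
have T0 : 0 < T by rewrite ltr_wpDl ?enorm_ge0.
pose h := Num.min (Num.min d1 d2 / 2) (`|D| / (2 * T ^+ 2)).
have h0 : 0 < h.
  by rewrite lt_min !divr_gt0 ?lt_min ?d10// mulr_gt0// exprn_gt0.
have hd : h < d1 /\ h < d2.
  have h1 : h <= Num.min d1 d2 / 2 by rewrite ge_min lexx.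
  have [m1 m2] : Num.min d1 d2 <= d1 /\ Num.min d1 d2 <= d2.
    by rewrite !ge_min !lexx orbT.
  by split; lra.
have hT : h * T ^+ 2 <= `|D| / 2.
  have : h <= `|D| / (2 * T ^+ 2) by rewrite ge_min lexx orbT.
  rewrite ler_pdivlMr ?mulr_gt0 ?exprn_gt0//; lra.
clearbody h.
pose k := Num.sg D * h.
have kh : `|k| = h by rewrite normrM normr_sg D0 mul1r gtr0_norm.
have ck : S (c k).
  by apply: cS2; rewrite -ball_normE /= sub0r normrN kh; case: hd.
have := cd k; rewrite kh add0r c0 => /(_ hd.1) rk.
have := xmin _ ck.
have -> : z - c k = (z - x) - (c k - x) by rewrite opprB addrA subrK.
rewrite ger_enorm_sqr ?enorm_ge0// enorm_sqr.
set r := c k - x - k *: tau in rk.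
have [w wE] : exists w, w = c k - x by exists (c k - x).
have wr : w = k *: tau + r by rewrite /r wE addrCA subrr addr0.
have wT : enorm w <= h * T.
  rewrite wr (le_trans (ler_enormD _ _))// enormZ kh mulrDr lerD2l//.
  by rewrite mulrC.
have zw : dotp (z - x) w = h * `|D| + dotp (z - x) r.
  by rewrite wr dotpDr dotpZr -/D /k normrEsg; ring.
have ru : - dotp (z - x) r <= N * (e * h).
  rewrite -dotpNl (le_trans (cauchy_schwarz _ _))// enormN -/N.
  by rewrite ler_wpM2l.
rewrite -wE; move: (z - x) zw ru => u zw ru; rewrite !dotpE (dotpC w).
rewrite -(enorm_sqr w) => H.
have w2 : enorm w ^+ 2 <= h * (h * T ^+ 2).
  rewrite mulrA -!expr2 -exprMn ler_pXn2r ?nnegrE ?enorm_ge0// mulr_ge0//.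
    exact: ltW.
  exact: ltW.
have hTT : h * (h * T ^+ 2) <= h * (`|D| / 2) by rewrite ler_pM2l.
have heN : h * (e * N) <= h * (`|D| / 4) by rewrite ler_pM2l.
have : 0 < h * `|D| by rewrite mulr_gt0.
lra.
Qed.

(** * Absolutely continuous paths and the transfer of costs *)

Section ControlledPaths.
Context {R : realType} {n : nat}.
Implicit Types (y : R -> 'rV[R]_n) (F : 'rV[R]_n -> 'rV[R]_n).

Lemma abs_continuous_comp F y :
  (forall b : R, 0 <= b -> exists2 L : R, 0 < L & forall s t, 0 <= s <= b -> 0 <= t <= b ->
     enorm (F (y s) - F (y t)) <= L * enorm (y s - y t)) ->
  abs_continuous y -> abs_continuous (F \o y).
Proof.
move=> FL yac b e b0 e0; have [L L0 LP] := FL b b0.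
have [d d0 dP] := yac b (e / L) b0 (divr_gt0 e0 L0); exists d => // m lo hi lohi disj small.
apply: le_lt_trans (_ : L * \sum_(i < m) enorm (y (hi i) - y (lo i)) < e); last first.
  by rewrite mulrC -ltr_pdivlMr//; exact: dP.
rewrite mulr_sumr; apply: ler_sum => i _; have [lo0 [lh hb]] := lohi i.
by apply: LP; rewrite ?lo0 ?hb ?(le_trans lo0 lh) ?(le_trans lh hb).
Qed.

Lemma abs_continuous_modulus y (b e : R) : abs_continuous y -> 0 <= b -> 0 < e ->
  exists2 d : R, 0 < d & forall s t, 0 <= s <= b -> 0 <= t <= b -> `|s - t| < d ->
    enorm (y s - y t) < e.
Proof.
move=> yac b0 e0; have [d d0 dP] := yac b e b0 e0; exists d => //.
have ordered s t : 0 <= s -> t <= b -> s <= t -> t - s < d -> enorm (y t - y s) < e.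
  move=> s0 tb st tsd.
  have := dP 1%N (fun=> s) (fun=> t); rewrite !big_ord1; apply => //.
  by move=> i j; rewrite (ord1 i) (ord1 j) eqxx.
move=> s t /andP[s0 sb] /andP[t0 tb] std; have [st|ts] := leP s t.
  rewrite enormB; apply: ordered => //.
  by rewrite -(ger0_norm (x := t - s)) ?subr_ge0// distrC.
by apply: ordered => //; [exact: ltW|rewrite -(gtr0_norm (x := s - t)) ?subr_gt0].
Qed.

Lemma abs_continuous_dist_bound (S : set 'rV[R]_n) (eps : R) y b :
  S !=set0 -> abs_continuous y -> 0 <= b ->
  (forall s, 0 <= s -> dist_to S (y s) < eps) ->
  exists2 m, m < eps & forall s, 0 <= s <= b -> dist_to S (y s) <= m.
Proof.
move=> S0 yac b0 yeps.
(* The path is controlled only at nonnegative times. Clamping time to [0, b] yields a globally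
   continuous function, whose maximum is attained and hence stays strictly below eps. *)
pose clamp (s : R) := Num.max 0 (Num.min s b).
have clamp_in s : 0 <= clamp s <= b.
  by rewrite /clamp le_max lexx ge_max b0 ge_min lexx orbT.
have clamp_id s : 0 <= s <= b -> clamp s = s.
  by move=> /andP[s0 sb]; rewrite /clamp (min_idPl sb) (max_idPr s0).
have clamp_lip s u : `|clamp s - clamp u| <= `|s - u|.
  have su : s - u <= `|s - u| := ler_norm _.
  have us : u - s <= `|s - u| by rewrite distrC ler_norm.
  rewrite /clamp ler_norml.
  by case: (leP s b) => ?; case: (leP u b) => ?; case: (leP 0 b) => ?; case: (leP 0 s) => ?;
    case: (leP 0 u) => ?; apply/andP; split; lra.
have cont : continuous (fun s => dist_to S (y (clamp s))).
  move=> s; apply/cvgrPdist_lt => e e0.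
  have [d d0 dP] := abs_continuous_modulus yac b0 e0.
  apply/nbhs_ballP; exists d => // u /= su.
  have := dP _ _ (clamp_in s) (clamp_in u) (le_lt_trans (clamp_lip _ _) su).
  apply: le_lt_trans; rewrite ler_norml; apply/andP; split.
    have := dist_to_lipschitz S0 (y (clamp u)) (y (clamp s)).
    by rewrite (enormB (y (clamp u))); lra.
  have := dist_to_lipschitz S0 (y (clamp s)) (y (clamp u)); lra.
have [c] := EVT_max b0 (continuous_subspaceT cont).
rewrite in_itv => /= cb cmax; exists (dist_to S (y c)).
  by apply: yeps; case/andP: cb.
move=> s sb; have := cmax s; rewrite in_itv /= => /(_ sb).
by rewrite !clamp_id.
Qed.

Lemma cost_transfer (r r' : 'rV[R]_n -> 'rV[R]_n -> R) (Tgt Tgt' : set 'rV[R]_n)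
    (g g' : 'rV[R]_n -> R) (a x y : R -> 'rV[R]_n) :
  (forall s, 0 <= s -> [/\ Tgt' (y s) <-> Tgt (x s), r' (y s) (a s) = r (x s) (a s)
                        & g' (y s) = g (x s)]) ->
  cost r' Tgt' g' a y = cost r Tgt g a x.
Proof.
move=> xy; rewrite /cost.
have -> : (exists2 s, 0 <= s & Tgt' (y s)) = (exists2 s, 0 <= s & Tgt (x s)).
  by apply/propext; split=> -[s s0 Ts]; exists s => //; have [TT _ _] := xy s s0; exact/TT.
have -> : first_hit Tgt' y = first_hit Tgt x.
  apply/seteqP; split=> T [T0 TT Tmin]; (split => //; first by have [? _ _] := xy T T0; tauto);
    move=> s s0 Ts; apply: Tmin => //; have [? _ _] := xy s s0; tauto.
case: ifP => // _; set T := get _.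
(* Without a first hitting time [get] returns the default point 0 of R, so T is nonnegative in
   either case. *)
have T0 : 0 <= T.
  rewrite /T; have [[s fs]|nofs] := pselect (exists s, first_hit Tgt x s).
    by have [] := getI fs.
  by rewrite getPN// => s fs; apply: nofs; exists s.
have [_ _ ->] := xy T T0; congr (_ + _)%E.
by apply: eq_integral => s; rewrite inE /= in_itv /= => /andP[s0 _]; have [_ ->] := xy s s0.
Qed.

End ControlledPaths.

(** The segment from p to q stays in the ball about c and so misses the boundary; the times it
    spends in Omega are then both open and closed in [0, 1]. *)
Lemma boundary_sign_change {R : realType} {n : nat} (Omega : set 'rV[R]_n) c p q (k : R) :
  open Omega -> k <= dist_to (boundary Omega) c -> enorm (p - c) < k ->
  enorm (q - c) < k -> Omega p -> Omega q.
Proof.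
move=> oO kc pk qk Op.
pose g (s : R) := p + s *: (q - p).
have g_cont : continuous g.
  move=> s; apply: cvgD; first exact: cvg_cst.
  by apply: cvgZr_tmp; exact: cvg_id.
have gG s : 0 <= s <= 1 -> ~ boundary Omega (g s).
  move=> /andP[s0 s1] Gg.
  have : k <= enorm (c - g s) := le_trans kc (dist_to_le c Gg).
  rewrite enormB.
  have -> : g s - c = (1 - s) *: (p - c) + s *: (q - c).
    by apply/rowP => i; rewrite !mxE; ring.
  apply/negP; rewrite -ltNge (le_lt_trans (ler_enormD _ _))// !enormZ.
  rewrite !ger0_norm ?subr_ge0//.
  have : (1 - s) * enorm (p - c) <= (1 - s) * Num.max (enorm (p - c)) (enorm (q - c)).
    by rewrite ler_wpM2l ?subr_ge0// le_max lexx.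
  have : s * enorm (q - c) <= s * Num.max (enorm (p - c)) (enorm (q - c)).
    by rewrite ler_wpM2l// le_max lexx orbT.
  have : Num.max (enorm (p - c)) (enorm (q - c)) < k by rewrite gt_max pk.
  lra.
have gE : `[0, 1]%classic `&` g @^-1` Omega = `[0, 1]%classic.
  apply: (segment_connected (a := 0) (b := 1)).
  - by exists 0; split; rewrite /= ?in_itv /= ?lexx ?ler01// /g scale0r addr0.
  - by exists (g @^-1` Omega) => //; move/continuousP: g_cont; exact.
  - exists (g @^-1` closure Omega).
      by move/continuous_closedP: g_cont; apply; exact: closed_closure.
    apply/seteqP; split=> s [s01 gs]; split => //; first exact: subset_closure.
    apply: contrapT => nO; apply: (gG s); first by move: s01; rewrite /= in_itv.
    split => //.
    by move/interior_id: oO => ->.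
have : `[0, 1]%classic (1 : R) by rewrite /= in_itv /= ler01 lexx.
by rewrite -gE => -[_]; rewrite /g /= scale1r addrC subrK.
Qed.

(** * Normals, feet and normal lines in the tube *)

Section TubularNeighborhood.
Context {R : realType} {n : nat} (n_gt0 : (0 < n)%N) (Omega : set 'rV[R]_n) (eps : R).
Let G := boundary Omega.
Let P := closest_point G.
Hypothesis G_neq0 : G !=set0.
Hypothesis Omega_open : open Omega.
Hypothesis Omega_smooth : smooth_boundary Omega.
Hypothesis eps_gt0 : 0 < eps.
Hypothesis unique_nearest :
  forall z, dist_to G z < eps -> exists! y, nearest G z y.
Hypothesis P_differentiable : forall z, tube Omega eps z -> differentiable P z.
Context (nu : 'rV[R]_n -> 'rV[R]_n) (t : 'rV[R]_n -> 'I_n.-1 -> 'rV[R]_n).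
Context (kappa sigma : 'rV[R]_n -> 'I_n.-1 -> R).
Hypothesis frame : forall z, tube Omega eps z ->
  principal_frame Omega eps nu z (t z) (kappa z) (sigma z).
Implicit Types (x y z w a b : 'rV[R]_n).

Let P_continuous z : dist_to G z < eps -> {for z, continuous P}.
Proof. by move=> /P_differentiable; exact: differentiable_continuous. Qed.

Lemma boundary_tube x : G x -> tube Omega eps x.
Proof. by move=> Gx; rewrite /tube /= dist_to_eq0. Qed.

Lemma signed_dist_boundary x : G x -> signed_dist Omega x = 0.
Proof. by move=> Gx; rewrite /signed_dist dist_to_eq0// oppr0 if_same. Qed.

(** The frame hypotheses speak of parallel surfaces; the boundary lies in the one at level 0. *)
Lemma tangent_parallel_surface x tau : G x -> tangent G x tau ->
  tangent (parallel_surface Omega eps (signed_dist Omega x)) x tau.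
Proof.
move=> Gx [c [c0 cG dc]]; exists c; split => //.
apply: filterS cG => s Gcs; split; first exact: boundary_tube.
by rewrite !signed_dist_boundary.
Qed.

Lemma normal_unit z : tube Omega eps z -> enorm (nu z) = 1.
Proof. by move=> /frame [[[]]]. Qed.

Lemma normal_tangent x tau : G x -> tangent G x tau -> dotp (nu x) tau = 0.
Proof.
move=> Gx /(tangent_parallel_surface Gx); have /frame [[[_ + _] _ _ _] _] := boundary_tube Gx.
exact.
Qed.

Lemma normal_frame z i : tube Omega eps z -> dotp (nu z) (t z i) = 0.
Proof. by move=> /frame [[[_ + _] + _ _] _] => nut tt; exact/nut/tt. Qed.

Lemma frame_orthonormal z : tube Omega eps z ->
  forall i j, dotp (t z i) (t z j) = (i == j)%:R.
Proof. by move=> /frame [[]]. Qed.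

Lemma sigma_neq0 z i : tube Omega eps z -> sigma z i != 0.
Proof. by move=> /frame [_ [_ _ s0]]; rewrite gt_eqF. Qed.

Lemma jacobian_closest_point z : tube Omega eps z ->
  'J P z = \sum_i sigma z i *: tensor (t z i) (t z i).
Proof. by move=> /frame [_ []]. Qed.

Lemma frame_jacobian z i : tube Omega eps z -> t z i *m 'J P z = sigma z i *: t z i.
Proof.
move=> Tz; rewrite jacobian_closest_point// mul_sum_tensor (bigD1 i)//= big1 ?addr0.
  by rewrite frame_orthonormal// eqxx mulr1.
by move=> j ji; rewrite frame_orthonormal// eq_sym (negbTE ji) mulr0 scale0r.
Qed.

(** Project a curve of the parallel surface with velocity [t z i]: the Jacobian of P scales that
    velocity by sigma. *)
Lemma frame_tangent z i : tube Omega eps z ->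
  tangent G (P z) (sigma z i *: t z i).
Proof.
move=> Tz; have [[_ /(_ i)[c [c0 cS dc]] _ _] _] := frame Tz.
exists (P \o c); split; first by rewrite /= c0.
  apply: filterS cS => s [Tcs _].
  exact: (closest_point_in unique_nearest).
rewrite -frame_jacobian//.
have := is_derive_compose_mx dc (F := P); rewrite c0.
by apply; exact: P_differentiable.
Qed.

Lemma closest_point_boundary z : tube Omega eps z -> G (P z).
Proof. exact: closest_point_in. Qed.

Lemma normal_foot_frame z i : tube Omega eps z -> dotp (nu (P z)) (t z i) = 0.
Proof.
move=> Tz; have := normal_tangent (closest_point_boundary Tz) (frame_tangent i Tz).
by rewrite dotpZr => /eqP; rewrite mulf_eq0 (negbTE (sigma_neq0 _ Tz)) => /eqP.
Qed.

Lemma orthogonal_frame_normal z w : tube Omega eps z ->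
  (forall i, dotp w (t z i) = 0) -> w = dotp w (nu z) *: nu z.
Proof.
move=> Tz; apply: orthogonal_to_frame => //.
- exact: frame_orthonormal.
- exact: normal_unit.
- by move=> i; exact: normal_frame.
Qed.

(** Both normals are unit vectors orthogonal to the n - 1 vectors [t z i]. The sign c need not be
    determined for what follows. *)
Lemma normal_foot z : tube Omega eps z ->
  exists2 c : R, `|c| = 1 & nu (P z) = c *: nu z.
Proof.
move=> Tz; exists (dotp (nu (P z)) (nu z)); last first.
  by apply: orthogonal_frame_normal => // i; exact: normal_foot_frame.
have := normal_unit (boundary_tube (closest_point_boundary Tz)).
rewrite {1}(orthogonal_frame_normal Tz (fun i => normal_foot_frame i Tz)).
by rewrite enormZ (normal_unit Tz) mulr1.
Qed.

Lemma tangent_foot_normal z a : tube Omega eps z -> tangent G (P z) a ->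
  dotp a (nu z) = 0.
Proof.
move=> Tz /(normal_tangent (closest_point_boundary Tz)).
have [c c1 ->] := normal_foot Tz; rewrite dotpZl dotpC => /eqP.
rewrite mulf_eq0 => /orP[/eqP c0|/eqP //].
by move: c1; rewrite c0 normr0 => /esym/eqP; rewrite oner_eq0.
Qed.

Lemma foot_boundary x : G x -> P x = x.
Proof. exact: (closest_point_id G_neq0 unique_nearest). Qed.

Lemma closest_point_decomposition z : tube Omega eps z ->
  z = P z + dotp (z - P z) (nu (P z)) *: nu (P z).
Proof.
move=> Tz; have Gx := closest_point_boundary Tz; have Tx := boundary_tube Gx.
suff <- : z - P z = dotp (z - P z) (nu (P z)) *: nu (P z) by rewrite addrC subrK.
apply: orthogonal_frame_normal => // i.
have := frame_tangent i Tx; rewrite foot_boundary// => tt.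
have := dotp_nearest_tangent (closest_point_nearest unique_nearest Tz) tt.
by rewrite dotpZr => /eqP; rewrite mulf_eq0 (negbTE (sigma_neq0 _ Tx)) => /eqP.
Qed.

(* To first order P(x + h u) = x for u normal, so nearby points x + h u have    *)
(* almost normal projection rays, along which the distance is known.           *)
Lemma dist_to_normal_line x u (s : R) : G x -> enorm u = 1 -> u *m 'J P x = 0 ->
  0 <= s -> s < eps -> dist_to G (x + s *: u) = s.
Proof.
move=> Gx u1 uJ; rewrite le_eqVlt => /predU1P[<- _|s0 se].
  by rewrite scale0r addr0 dist_to_eq0.
(* The error in the distance is bounded by a multiple of an arbitrarily small k, so it vanishes. *)
have approx (k : R) : 0 < k -> k <= 1 / 2 ->
    `|dist_to G (x + s *: u) - s| <= k * (1 + 4 * s).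
  move=> k0 k12.
  have [d d0 dP] := differentiable_enorm (P_differentiable (boundary_tube Gx)) k0.
  pose h := Num.min (Num.min d 1) s / 2.
  have m0 : 0 < Num.min (Num.min d 1) s by rewrite !lt_min d0 ltr01.
  have [h0 [hd h1 hs]] : 0 < h /\ [/\ h < d, h <= 1 & 2 * h <= s].
    have [m1 m2] : Num.min (Num.min d 1) s <= Num.min d 1 /\ Num.min (Num.min d 1) s <= s.
      by split; rewrite ge_min lexx ?orbT.
    have [m3 m4] : Num.min d 1 <= d /\ Num.min d 1 <= (1 : R).
      by split; rewrite ge_min lexx ?orbT.
    by rewrite /h; split; [|split]; lra.
  clearbody h.
  have hu : enorm (h *: u) = h by rewrite enormZ u1 mulr1 gtr0_norm.
  have := dP (h *: u); rewrite hu -scalemxAl uJ scaler0 subr0 (foot_boundary Gx) => /(_ hd) Pz.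
  pose z := x + h *: u.
  have zx : enorm (z - x) = h by rewrite /z addrAC subrr add0r.
  have Tz : dist_to G z < eps.
    apply: (le_lt_trans (dist_to_le z Gx)); rewrite zx; lra.
  rewrite -/z in Pz; set q := P z - x in Pz.
  have Eq : z - P z = h *: u - q by rewrite /q /z opprB addrCA addrA.
  pose e := enorm (z - P z).
  have [eh he] : h - k * h <= e /\ e <= h + k * h.
    rewrite /e Eq; split; last first.
      by rewrite (le_trans (ler_enormB _ _))// hu lerD2l.
    have := ler_enormD (h *: u - q) q; rewrite subrK hu; lra.
  have kh : k * h <= 1 / 2 * h by rewrite ler_pM2r.
  have e0 : 0 < e by lra.
  have ees : e <= s by lra.
  pose v := e^-1 *: (z - P z).
  have v1 : enorm v = 1 by rewrite enormZ normfV gtr0_norm// mulVf// gt_eqF.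
  have ev : e *: v = z - P z by rewrite scalerA mulfV ?scale1r// gt_eqF.
  have ray : dist_to G (P z + s *: v) = s.
    apply: (dist_to_ray G_neq0 unique_nearest P_continuous _ v1 e0 ees se).
      exact: (closest_point_in unique_nearest).
    by rewrite ev addrC subrK /e (enorm_closest_point G_neq0 unique_nearest).
  (* The foot of x + h u is off x by at most k h, and the length e of the projection segment is at
     least h / 2. *)
  have uv : enorm (u - v) <= 4 * k.
    rewrite -(ler_pM2l e0) -{1}(gtr0_norm e0) -enormZ scalerBr ev Eq.
    have -> : e *: u - (h *: u - q) = (e - h) *: u + q.
      by rewrite opprB addrCA addrC scalerBl.
    rewrite (le_trans (ler_enormD _ _))// enormZ u1 mulr1.
    have : `|e - h| <= k * h by rewrite ler_norml; apply/andP; split; lra.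
    have : k * h <= k * (2 * e) by rewrite ler_pM2l//; lra.
    lra.
  have close : enorm (x + s *: u - (P z + s *: v)) <= k + 4 * k * s.
    have -> : x + s *: u - (P z + s *: v) = s *: (u - v) - q.
      by rewrite /q scalerBr opprD opprB addrACA addrC addrA.
    rewrite (le_trans (ler_enormB _ _))// addrC lerD//.
      by rewrite (le_trans Pz)// ler_piMr// ltW.
    by rewrite enormZ gtr0_norm// mulrC ler_pM2r.
  have := dist_to_lipschitz G_neq0 (x + s *: u) (P z + s *: v).
  have := dist_to_lipschitz G_neq0 (P z + s *: v) (x + s *: u).
  rewrite (enormB (P z + _)) ray => H1 H2.
  by rewrite ler_norml; apply/andP; split; lra.
apply/eqP; rewrite -subr_eq0; apply/negPn/negP => D0.
have Dgt0 : 0 < `|dist_to G (x + s *: u) - s| by rewrite normr_gt0.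
set D := `|_| in Dgt0 approx.
have s4 : 0 < 1 + 4 * s by lra.
have := approx (Num.min (1 / 2) (D / (2 * (1 + 4 * s)))).
rewrite ge_min lexx lt_min !divr_gt0 ?mulr_gt0// => /(_ isT isT).
have : Num.min (1 / 2) (D / (2 * (1 + 4 * s))) * (1 + 4 * s) <= D / 2.
  by rewrite -ler_pdivlMr// ge_min invfM mulrA lexx orbT.
lra.
Qed.

Lemma normal_jacobian z : tube Omega eps z -> nu z *m 'J P z = 0.
Proof.
move=> Tz; rewrite jacobian_closest_point// mul_sum_tensor big1// => i _.
by rewrite normal_frame// mulr0 scale0r.
Qed.

Lemma dist_to_normal x (s : R) : G x -> `|s| < eps -> dist_to G (x + s *: nu x) = `|s|.
Proof.
move=> Gx; have Tx := boundary_tube Gx; have [s0 se|s0 se] := ger0P s.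
  by apply: dist_to_normal_line => //; [exact: normal_unit|exact: normal_jacobian].
have -> : s *: nu x = - s *: - nu x by rewrite scalerN scaleNr opprK.
apply: dist_to_normal_line => //.
- by rewrite enormN normal_unit.
- by rewrite mulNmx normal_jacobian// oppr0.
- by rewrite oppr_ge0 ltW.
Qed.

Lemma closest_point_normal x (s : R) : G x -> `|s| < eps -> P (x + s *: nu x) = x.
Proof.
move=> Gx se; apply: (closest_point_eq G_neq0 unique_nearest Gx).
  rewrite addrAC subrr add0r enormZ normal_unit ?mulr1 ?dist_to_normal//.
  exact: boundary_tube.
by rewrite dist_to_normal.
Qed.

(** * Touching balls on both sides and the Lipschitz normal *)

Lemma normal_exits x : G x ->
  exists2 d : R, 0 < d & forall h, 0 < h -> h < d -> ~ Omega (x + h *: nu x).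
Proof.
move=> Gx; have [[[_ _ inc] _ _ _] _] := frame (boundary_tube Gx).
have : nbhs (0 : R) (fun s => 0 < s ->
    signed_dist Omega x < signed_dist Omega (x + s *: nu x)).
  exact: inc.
move=> /nbhs_ballP[d /= d0 dP]; exists d => // h h0 hd Oh.
have := dP h; rewrite -ball_normE /= sub0r normrN gtr0_norm// => /(_ hd h0).
rewrite signed_dist_boundary// /signed_dist mem_set//.
by rewrite oppr_gt0 ltNge dist_to_ge0.
Qed.

(* The defining function has zero derivative along the tangent frame and       *)
(* nonzero differential, so it is strictly monotone across the boundary.       *)
Lemma normal_enters x : G x ->
  exists2 d : R, 0 < d & forall h, 0 < h -> h < d -> Omega (x - h *: nu x).
Proof.
move=> Gx; have Tx := boundary_tube Gx.
have [U [phi [oU Ux smooth [v dv] UP]]] := Omega_smooth Gx.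
have dphi : differentiable phi x := smooth [::] x Ux.
have phix : phi x = 0 by apply/(UP x Ux).2.
have tangent0 tau : tangent G x tau -> 'd phi x tau = 0.
  move=> [c [c0 cG dc]].
  rewrite -c0 in dphi; have [_ dphic] := is_derive_compose dc dphi.
  rewrite -c0 -dphic.
  have near0 : \forall s \near (0 : R), (phi \o c) s = cst 0 s.
    have cc : {for 0, continuous c}.
      by apply: differentiable_continuous; apply/derivable1_diffP; case: dc.
    have Uc : \forall s \near (0 : R), U (c s).
      by apply: cc; rewrite c0; exact: open_nbhs_nbhs.
    by apply: filterS2 cG Uc => s Gs Us; exact/(UP _ Us).2.
  by rewrite (near_eq_derive _ near0) derive_cst.
have dt i : 'd phi x (t x i) = 0.
  have := frame_tangent i Tx; rewrite foot_boundary// => /tangent0.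
  rewrite linearZ => /eqP; rewrite scaler_eq0 (negbTE (sigma_neq0 _ Tx)).
  by move=> /eqP.
have dnu : 'd phi x (nu x) != 0.
  apply: contraNneq dv => dnu0; rewrite deriveE//.
  rewrite (orthonormal_expansion n_gt0 (frame_orthonormal Tx) (normal_unit Tx)
    (fun i => normal_frame i Tx) v).
  rewrite linearD linear_sum linearZ dnu0 [X in _ + X]mulr0 addr0 big1// => i _.
  by rewrite linearZ dt [LHS]mulr0.
have monotone (k : R) : k * 'd phi x (nu x) < 0 -> `|k| = 1 ->
    exists2 d : R, 0 < d & forall h, 0 < h -> h < d -> Omega (x + h *: (k *: nu x)).
  move=> kneg k1; have e0 : 0 < - (k * 'd phi x (nu x)) / 2.
    by rewrite divr_gt0// oppr_gt0.
  have [d d0 dP] := littleo_enorm dphi e0.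
  have /nbhs_enormP[r r0 rU] : nbhs x U by exact: open_nbhs_nbhs.
  exists (Num.min d r); first by rewrite lt_min d0.
  move=> h h0; rewrite lt_min => /andP[hd hr].
  have hk : enorm (h *: (k *: nu x)) = h.
    by rewrite !enormZ k1 normal_unit// !mulr1 gtr0_norm.
  apply/(UP _ _).1; first by apply: rU; rewrite addrAC subrr add0r hk.
  have := dP (h *: (k *: nu x)); rewrite hk => /(_ hd).
  rewrite phix subr0 !linearZ /= ler_norml => /andP[_].
  have : 0 < h * - (k * 'd phi x (nu x)) by rewrite mulr_gt0// oppr_gt0.
  rewrite /GRing.scale /=; lra.
(* In the first case the derivative along [nu x] is negative, so points x + h nu would lie in Omega,
   against [normal_exits]. *)
have [dpos|dneg|d0] := ltgtP ('d phi x (nu x)) 0; last by rewrite d0 eqxx in dnu.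
  have [||d d0 dP] := monotone 1; rewrite ?mul1r ?normr1//.
  have [r r0 rP] := normal_exits Gx.
  pose h := Num.min d r / 2.
  have m0 : 0 < Num.min d r by rewrite lt_min d0.
  have [m1 m2] : Num.min d r <= d /\ Num.min d r <= r by split; rewrite ge_min lexx ?orbT.
  exfalso; apply: (rP h); rewrite /h ?divr_gt0//; first by lra.
  have := dP h; rewrite scale1r; apply; rewrite /h ?divr_gt0//; lra.
have [||d d0 dP] := monotone (- 1); rewrite ?mulN1r ?oppr_lt0 ?normrN1//.
by exists d => // h h0 hd; have := dP h h0 hd; rewrite scaleN1r scalerN.
Qed.

(** By [dist_to_normal] the ball misses the boundary, so it lies on one side, and near x it contains
    points x + h nu outside Omega. *)
Lemma exterior_ball x y (s : R) : G x -> 0 < s -> s < eps ->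
  enorm (y - (x + s *: nu x)) < s -> ~ Omega y.
Proof.
move=> Gx s0 se ys Oy; have [d d0 dP] := normal_exits Gx.
have m0 : 0 < Num.min d s by rewrite lt_min d0.
have [m1 m2] : Num.min d s <= d /\ Num.min d s <= s by split; rewrite ge_min lexx ?orbT.
apply: (dP (Num.min d s / 2)); [by rewrite divr_gt0|by lra|].
apply: (boundary_sign_change Omega_open _ ys _ Oy).
  by rewrite dist_to_normal ?gtr0_norm.
rewrite opprD addrACA subrr add0r -scalerBl enormZ normal_unit; last exact: boundary_tube.
by rewrite mulr1 ltr0_norm; lra.
Qed.

Lemma interior_ball x y (s : R) : G x -> 0 < s -> s < eps ->
  enorm (y - (x - s *: nu x)) < s -> Omega y.
Proof.
move=> Gx s0 se ys; have [d d0 dP] := normal_enters Gx.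
have m0 : 0 < Num.min d s by rewrite lt_min d0.
have [m1 m2] : Num.min d s <= d /\ Num.min d s <= s by split; rewrite ge_min lexx ?orbT.
have Op : Omega (x - (Num.min d s / 2) *: nu x) by apply: dP; [rewrite divr_gt0|lra].
apply: (boundary_sign_change Omega_open _ _ ys Op).
  by rewrite -scaleNr dist_to_normal ?normrN ?gtr0_norm.
rewrite opprD addrACA subrr add0r -scaleNr opprK -scalerDl enormZ normal_unit;
  last exact: boundary_tube.
by rewrite mulr1 gtr0_norm; lra.
Qed.

(** If the centres were closer, their midpoint would lie in both balls, hence both inside and
    outside Omega. *)
Lemma opposite_balls_disjoint a b (s : R) : G a -> G b -> 0 < s -> s < eps ->
  2 * s <= enorm (a + s *: nu a - (b - s *: nu b)).
Proof.
move=> Ga Gb s0 se; rewrite leNgt; apply/negP => close.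
set c1 := a + s *: nu a in close; set c2 := b - s *: nu b in close.
have half : forall u : 'rV[R]_n, enorm u < 2 * s -> enorm (2^-1 *: u) < s.
  by move=> u us; rewrite enormZ ger0_norm// ltr_pdivrMl.
apply: (@exterior_ball a (2^-1 *: (c1 + c2)) s Ga s0 se); rewrite -/c1.
  have -> : 2^-1 *: (c1 + c2) - c1 = 2^-1 *: (c2 - c1).
    by apply/rowP => i; rewrite !mxE; field.
  by apply: half; rewrite enormB.
apply: (@interior_ball b (2^-1 *: (c1 + c2)) s Gb s0 se); rewrite -/c2.
have -> : 2^-1 *: (c1 + c2) - c2 = 2^-1 *: (c1 - c2).
  by apply/rowP => i; rewrite !mxE; field.
exact: half.
Qed.

(** Add the squared inequalities for (a, b) and (b, a): the cross terms cancel, and |nu a + nu b|^2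
    = 4 - |nu a - nu b|^2. *)
Lemma normal_lipschitz a b (s : R) : G a -> G b -> 0 < s -> s < eps ->
  s * enorm (nu a - nu b) <= enorm (a - b).
Proof.
move=> Ga Gb s0 se.
have := opposite_balls_disjoint Ga Gb s0 se.
have := opposite_balls_disjoint Gb Ga s0 se.
have s20 : 0 <= 2 * s by rewrite mulr_ge0// ltW.
have -> : b + s *: nu b - (a - s *: nu a) = - (a - b) + s *: (nu a + nu b).
  by apply/rowP => i; rewrite !mxE; ring.
have -> : a + s *: nu a - (b - s *: nu b) = (a - b) + s *: (nu a + nu b).
  by apply/rowP => i; rewrite !mxE; ring.
rewrite (ger_enorm_sqr _ s20) => H1; rewrite (ger_enorm_sqr _ s20) => H2.
rewrite -{1}(gtr0_norm s0) -enormZ ler_enorm_sqr ?enorm_ge0// enorm_sqr.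
have na : dotp (nu a) (nu a) = 1.
  by rewrite -enorm_sqr normal_unit ?expr1n//; exact: boundary_tube.
have nb : dotp (nu b) (nu b) = 1.
  by rewrite -enorm_sqr normal_unit ?expr1n//; exact: boundary_tube.
move: (a - b) H1 H2 => w H1 H2.
move: H1 H2; rewrite !dotpE na nb (dotpC (nu b) (nu a)) !(dotpC _ w); lra.
Qed.

Lemma offset_lipschitz a b (s eta : R) : G a -> G b -> 0 < s -> s < eps ->
  enorm (a + eta *: nu a - (b + eta *: nu b)) <= (1 + `|eta| / s) * enorm (a - b).
Proof.
move=> Ga Gb s0 se; rewrite opprD addrACA -scalerBr.
rewrite (le_trans (ler_enormD _ _))// mulrDl mul1r lerD2l enormZ -mulrA ler_wpM2l//.
by rewrite ler_pdivlMl// normal_lipschitz.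
Qed.

(** * The tensor B against the Jacobian, and the velocity of a lifted path *)

Lemma mul_Btensor z a (mu : R) : dotp a (nu z) = 0 ->
  a *m Btensor (t z) (sigma z) (nu z) mu =
  \sum_i ((sigma z i)^-1 * dotp a (t z i)) *: t z i.
Proof.
move=> anu; rewrite mulmxDr mul_sum_tensor -scalemxAr mul_tensor anu.
by rewrite scale0r scaler0 addr0.
Qed.

Lemma Btensor_jacobian z a (mu : R) : tube Omega eps z -> dotp a (nu z) = 0 ->
  a *m Btensor (t z) (sigma z) (nu z) mu *m 'J P z = a.
Proof.
move=> Tz anu; rewrite mul_Btensor// mulmx_suml.
rewrite [RHS](orthonormal_expansion n_gt0 (frame_orthonormal Tz) (normal_unit Tz)
    (fun i => normal_frame i Tz)) anu scale0r addr0.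
apply: eq_bigr => i _; rewrite -scalemxAl frame_jacobian// scalerA.
by rewrite mulrAC mulVf ?mul1r ?sigma_neq0.
Qed.

(** Recovers an increment w from its image under the Jacobian and its normal component; mu = 1 is
    the value covered by [frame_inverse]. *)
Lemma jacobian_Btensor z w : tube Omega eps z ->
  w = w *m 'J P z *m Btensor (t z) (sigma z) (nu z) 1 + dotp w (nu z) *: nu z.
Proof.
move=> Tz; have := frame_inverse n_gt0 (frame_orthonormal Tz) (normal_unit Tz)
  (fun i => normal_frame i Tz) (fun i => sigma_neq0 i Tz).
rewrite -jacobian_closest_point// => inv.
rewrite -[LHS]mulmx1 -inv mulmxA [w *m (_ + _)]mulmxDr mulmxDl /Btensor scale1r; congr (_ + _).
rewrite mul_tensor -scalemxAl mulmxDr mul_sum_tensor mul_tensor -enorm_sqr.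
rewrite normal_unit// expr1n scale1r big1 ?add0r// => i _.
by rewrite normal_frame// mulr0 scale0r.
Qed.

(** Only directional derivatives of [nu] are given, so the increment D of the lift is determined
    indirectly. Since P sends the lift to x, differentiability of P gives D 'J P z = h w + o(h); the
    component of D along the normal is o(h) because [nu] is unit and Lipschitz. [jacobian_Btensor]
    assembles the two. *)
Lemma is_derive_offset (x : R -> 'rV[R]_n) (s0 : R) w (eta mu : R) :
  (forall s, 0 <= s -> G (x s)) -> 0 < s0 -> is_derive s0 (1 : R) x w ->
  dotp w (nu (x s0)) = 0 -> `|eta| < eps ->
  let z := x s0 + eta *: nu (x s0) in
  is_derive s0 (1 : R) (fun s => x s + eta *: nu (x s))
    (w *m Btensor (t z) (sigma z) (nu z) mu).
Proof.
move=> xG s00 /is_derive_enormP dx wn etae z.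
have G0 : G (x s0) by apply: xG; exact: ltW.
have Tz : tube Omega eps z by rewrite /tube /= dist_to_normal.
have Pz : P z = x s0 by rewrite closest_point_normal.
have wz : dotp w (nu z) = 0.
  have [c c1 nuE] := normal_foot Tz; move: wn; rewrite -Pz nuE dotpZr => /eqP.
  rewrite mulf_eq0 => /orP[/eqP c0|/eqP //].
  by move: c1; rewrite c0 normr0 => /esym/eqP; rewrite oner_eq0.
rewrite (mul_Btensor mu wz) -(mul_Btensor 1 wz).
set B := Btensor _ _ _ _.
have [C C0 CP] := enorm_mulmx_bounded B.
pose s := eps / 2; have sgt0 : 0 < s by rewrite divr_gt0.
have se : s < eps by rewrite /s ltr_pdivrMr// ltr_pMr// ltr1n.
pose L := 1 + `|eta| / s.
have L0 : 0 <= L by rewrite addr_ge0// divr_ge0// ltW.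
pose W := enorm w + 1.
have W0 : 0 <= W by rewrite addr_ge0// enorm_ge0.
(* The total error will be at most (k K + E |h|) |h|; k and the bound on |h| make each summand in
   the bracket at most e / 2. *)
pose K := C * (L * W + 1) + 1.
have K0 : 0 < K by rewrite ltr_wpDl// mulr_ge0// addr_ge0// mulr_ge0.
pose E := `|eta| / 2 * (W / s) ^+ 2.
have E0 : 0 <= E by rewrite mulr_ge0 ?sqr_ge0// divr_ge0.
apply/is_derive_enormP => e e0.
pose k := Num.min 1 (e / (2 * K)).
have k0 : 0 < k by rewrite lt_min ltr01 divr_gt0// mulr_gt0.
have k1 : k <= 1 by rewrite ge_min lexx.
have kK : k * K <= e / 2.
  have : k <= e / (2 * K) by rewrite ge_min lexx orbT.
  rewrite ler_pdivlMr ?mulr_gt0//; lra.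
clearbody k.
have [d1 d10 xd] := dx _ k0.
have [d2 d20 Pd] := differentiable_enorm (P_differentiable Tz) k0.
have LW0 : 0 < L * W + 1 by rewrite ltr_wpDl// mulr_ge0.
have E10 : 0 < E + 1 by rewrite ltr_wpDl.
exists (Num.min (Num.min d1 s0) (Num.min (d2 / (L * W + 1)) (e / (2 * (E + 1))))).
  by rewrite !lt_min d10 s00 !divr_gt0// mulr_gt0.
move=> h; rewrite !lt_min => /andP[/andP[hd1 hs0] /andP[hd2 hE]].
have Gh : G (x (s0 + h)).
  by apply: xG; move: hs0; rewrite ltr_norml => /andP[? _]; lra.
set D := x (s0 + h) + eta *: nu (x (s0 + h)) - (x s0 + eta *: nu (x s0)).
have [Dx DxE] : exists Dx, Dx = x (s0 + h) - x s0 by exists (x (s0 + h) - x s0).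
have h0 : 0 <= `|h| := normr_ge0 _.
have rk : enorm (Dx - h *: w) <= k * `|h| by rewrite DxE; exact: xd.
have DxW : enorm Dx <= W * `|h|.
  have := ler_enormD (Dx - h *: w) (h *: w); rewrite subrK enormZ => H.
  have : k * `|h| <= 1 * `|h| by rewrite ler_wpM2r.
  rewrite /W; lra.
have DL : enorm D <= L * W * `|h|.
  rewrite -mulrA (le_trans _ (ler_wpM2l L0 DxW))// DxE.
  exact: (offset_lipschitz eta Gh G0 sgt0 se).
have Dd2 : enorm D < d2.
  apply: le_lt_trans DL _; move: hd2; rewrite ltr_pdivlMr//.
  by apply: le_lt_trans; rewrite mulrC ler_wpM2l// lerDl.
have DJ : enorm (D *m 'J P z - h *: w) <= k * (L * W + 1) * `|h|.
  have zD : z + D = x (s0 + h) + eta *: nu (x (s0 + h)).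
    by rewrite /D addrCA subrr addr0.
  have := Pd _ Dd2; rewrite zD closest_point_normal// Pz -DxE => H.
  have -> : D *m 'J P z - h *: w = (Dx - h *: w) - (Dx - D *m 'J P z).
    by rewrite opprB [RHS]addrC addrA subrK.
  rewrite (le_trans (ler_enormB _ _))//.
  have : k * enorm D <= k * (L * W * `|h|) by rewrite ler_pM2l.
  lra.
have Dn : `|dotp D (nu (x s0))| <= k * `|h| + E * (`|h| * `|h|).
  have n1 y : G y -> dotp (nu y) (nu y) = 1.
    by move=> Gy; rewrite -enorm_sqr normal_unit ?expr1n//; exact: boundary_tube.
  (* For unit vectors, (nu' - nu) . nu = - |nu' - nu|^2 / 2, which is quadratic in h by
     [normal_lipschitz]. *)
  have -> : dotp D (nu (x s0)) = dotp (Dx - h *: w) (nu (x s0))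
      - eta / 2 * dotp (nu (x (s0 + h)) - nu (x s0)) (nu (x (s0 + h)) - nu (x s0)).
    by rewrite /D DxE !dotpE wn !n1// (dotpC (nu (x s0)) (nu (x (s0 + h)))); field.
  rewrite (le_trans (ler_normB _ _))// lerD//.
    rewrite (le_trans (cauchy_schwarz_norm _ _))// normal_unit ?mulr1//.
    exact: boundary_tube.
  rewrite -enorm_sqr normrM normf_div (ger0_norm (sqr_ge0 _)) (gtr0_norm (x := 2))//.
  have nud : enorm (nu (x (s0 + h)) - nu (x s0)) <= W / s * `|h|.
    rewrite mulrAC ler_pdivlMr// mulrC (le_trans (normal_lipschitz Gh G0 sgt0 se))//.
    by rewrite -DxE.
  rewrite /E -mulrA ler_wpM2l ?divr_ge0// -[`|h| * _]expr2 -exprMn.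
  by rewrite lerXn2r ?nnegrE ?enorm_ge0// (le_trans (enorm_ge0 _) nud).
have Dnz : enorm (dotp D (nu z) *: nu z) = `|dotp D (nu (x s0))|.
  have [c c1 nuE] := normal_foot Tz.
  by rewrite enormZ normal_unit// mulr1 -Pz nuE dotpZr normrM c1 mul1r.
clearbody D.
have -> : D - h *: (w *m B) = (D *m 'J P z - h *: w) *m B + dotp D (nu z) *: nu z.
  by rewrite {1}[D](jacobian_Btensor D Tz) mulmxBl -scalemxAl addrAC.
rewrite (le_trans (ler_enormD _ _))// Dnz.
have := CP (D *m 'J P z - h *: w).
have : C * enorm (D *m 'J P z - h *: w) <= C * (k * (L * W + 1) * `|h|).
  exact: ler_wpM2l.
have : k * K * `|h| <= e / 2 * `|h| by rewrite ler_wpM2r.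
have : (E + 1) * `|h| * `|h| <= e / 2 * `|h|.
  rewrite ler_wpM2r//; move: hE; rewrite ltr_pdivlMr ?mulr_gt0//; lra.
have : 0 <= `|h| * `|h| by rewrite mulr_ge0.
rewrite /K; lra.
Qed.

(** * The correspondence of admissible paths and of values *)

Section Paths.
Context (f : 'rV[R]_n -> 'rV[R]_n -> R) (mu : R).
Let surface_velocity x a := f x a *: a.
Let extended_velocity z a :=
  f (P z) a *: (a *m Btensor (t z) (sigma z) (nu z) mu).
Let surface_admissible := admissible G G surface_velocity (unit_tangents G).
Let extended_admissible := admissible G (tube Omega eps) extended_velocity
  (fun z => unit_tangents G (P z)).

(** By the chain rule the projected velocity is f a B 'J P, which is f a because a is tangent at the
    foot and hence orthogonal to [nu (y s)]. *)
Lemma admissible_projection z (a y : R -> 'rV[R]_n) :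
  extended_admissible z (a, y) -> surface_admissible (P z) (a, P \o y).
Proof.
move=> [/= ca [y0 yT yac dy] aT]; split => //=; split.
- by rewrite /= y0.
- by move=> s s0; exact: closest_point_boundary (yT s s0).
- apply: (abs_continuous_comp _ yac) => b b0.
  have [m me ym] := abs_continuous_dist_bound G_neq0 yac b0 yT.
  (* On [0, b] the path stays within m' < eps of the boundary, so an s strictly between m' and eps
     gives a finite Lipschitz constant for P there. *)
  pose m' := Num.max m 0; pose s := (m' + eps) / 2.
  have m'e : m' < eps by rewrite gt_max me.
  have m's : m' < s by rewrite /s; lra.
  have se : s < eps by rewrite /s; lra.
  have m'0 : 0 <= m' by rewrite le_max lexx orbT.
  exists (s / (s - m')); first by rewrite divr_gt0 ?subr_gt0// (le_lt_trans m'0).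
  move=> s1 s2 s1b s2b.
  apply: (closest_point_lipschitz G_neq0 unique_nearest P_continuous) => //.
    by rewrite le_max ym.
  by rewrite le_max ym.
- apply: filterS dy; first exact: (ae_filter_ringOfSetsType lebesgue_measure).
  move=> s ds s0.
  have Ty : tube Omega eps (y s) by apply: yT; exact: ltW.
  have [aTs _] := aT s (ltW s0).
  have anu := tangent_foot_normal Ty aTs.
  have := is_derive_compose_mx (ds s0) (P_differentiable Ty).
  by rewrite /extended_velocity -scalemxAl Btensor_jacobian.
Qed.

(** Lift at the constant offset eta along the normal that carries [P z] to z; |eta| < eps keeps the
    lift in the tube with foot x. *)
Lemma admissible_offset z (a x : R -> 'rV[R]_n) : tube Omega eps z ->
  surface_admissible (P z) (a, x) ->
  exists2 y, extended_admissible z (a, y) &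
    forall s, 0 <= s -> tube Omega eps (y s) /\ P (y s) = x s.
Proof.
move=> Tz [/= ca [x0 xG xac dx] aT].
have zE := closest_point_decomposition Tz; set eta := dotp _ _ in zE.
have etae : `|eta| < eps.
  have := Tz; rewrite /tube /= -(enorm_closest_point G_neq0 unique_nearest)//.
  apply: le_lt_trans; rewrite (le_trans (cauchy_schwarz_norm _ _))// normal_unit ?mulr1//.
  exact/boundary_tube/closest_point_boundary.
have offT s : 0 <= s -> tube Omega eps (x s + eta *: nu (x s)).
  by move=> s0; rewrite /tube /= dist_to_normal//; exact: xG.
have offP s : 0 <= s -> P (x s + eta *: nu (x s)) = x s.
  by move=> s0; rewrite closest_point_normal//; exact: xG.
exists (fun s => x s + eta *: nu (x s)); last by move=> s s0; split; [exact: offT|exact: offP].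
split => //=; last by move=> s s0; rewrite offP//; exact: aT.
split => //.
- by rewrite x0 -zE.
- apply: (@abs_continuous_comp _ _ (fun v => v + eta *: nu v)) xac => b b0.
  exists (1 + `|eta| / (eps / 2)).
    by rewrite ltr_wpDr// divr_ge0// divr_ge0// ltW.
  move=> s1 s2 /andP[s10 _] /andP[s20 _].
  apply: offset_lipschitz; [exact: xG|exact: xG|by rewrite divr_gt0|].
  by rewrite ltr_pdivrMr// ltr_pMr// ltr1n.
- apply: filterS dx; first exact: (ae_filter_ringOfSetsType lebesgue_measure).
  move=> s ds s0.
  have [aTs _] := aT s (ltW s0).
  have anu : dotp (surface_velocity (x s) (a s)) (nu (x s)) = 0.
    by rewrite dotpZl dotpC (normal_tangent (xG s (ltW s0)) aTs) mulr0.
  have := is_derive_offset mu xG s0 (ds s0) anu etae.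
  by rewrite /= /extended_velocity offP ?ltW// /surface_velocity -scalemxAl.
Qed.

Lemma extended_value_surface_value (r : 'rV[R]_n -> 'rV[R]_n -> R) (Tgt : set 'rV[R]_n)
    (g : 'rV[R]_n -> R) z : tube Omega eps z ->
  extended_value G (tube Omega eps) (fun z => Btensor (t z) (sigma z) (nu z) mu)
    f r Tgt g z = surface_value G f r Tgt g (P z).
Proof.
move=> Tz; congr ereal_inf; apply/seteqP; split=> c [[a y] /= adm <-].
  exists (a, P \o y) => /=; first exact: admissible_projection.
  apply/esym/cost_transfer => s s0; split=> //=; have [_ [_ yT _ _] _] := adm.
  by split=> [[]//|Ty]; split=> //; exact: yT.
have [y' adm' yP] := admissible_offset Tz adm; exists (a, y') => //=.
apply: cost_transfer => s s0; have [Ty yE] := yP s s0.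
by rewrite /= -/P yE; split=> //; split=> [[]//|Ts]; split.
Qed.

End Paths.

End TubularNeighborhood.

Unset Implicit Arguments.

Theorem corollary2p2 (R : realType) (n : nat) (n23 : n = 2%N \/ n = 3%N)
  (Omega : set 'rV[R]_n) (Omega_neq0 : Omega !=set0)
  (Omega_bounded : bounded_set Omega) (Omega_connected : connected Omega)
  (Omega_open : open Omega) (Omega_smooth : smooth_boundary Omega)
  (eps : R) (eps_gt0 : 0 < eps)
  (eps_reach : (eps%:E < reach (boundary Omega))%E)
  (P_differentiable : forall z, tube Omega eps z ->
     differentiable (closest_point (boundary Omega)) z)
  (nu : 'rV[R]_n -> 'rV[R]_n) (t : 'rV[R]_n -> 'I_n.-1 -> 'rV[R]_n)
  (kappa sigma : 'rV[R]_n -> 'I_n.-1 -> R)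
  (frame : forall z, tube Omega eps z ->
     principal_frame Omega eps nu z (t z) (kappa z) (sigma z))
  (mu : R)
  (Tgt : set 'rV[R]_n) (Tgt_closed : closed Tgt)
  (Tgt_sub : Tgt `<=` boundary Omega)
  (f r : 'rV[R]_n -> 'rV[R]_n -> R) (g : 'rV[R]_n -> R)
  (f_lipschitz : exists L : R, forall a, all_unit_tangents (boundary Omega) a ->
     L.-lipschitz_(boundary Omega) (fun x => f x a))
  (r_lipschitz : exists L : R, forall a, all_unit_tangents (boundary Omega) a ->
     L.-lipschitz_(boundary Omega) (fun x => r x a))
  (g_lsc : lower_semicontinuous (fun x : subspace Tgt => (g x)%:E))
  (g_min : exists2 x0, Tgt x0 & forall x, Tgt x -> g x0 <= g x)
  (R1 R2 F1 F2 : R) (R1_gt0 : 0 < R1) (F1_gt0 : 0 < F1)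
  (r_bounds : forall x a, boundary Omega x ->
     all_unit_tangents (boundary Omega) a -> R1 <= r x a <= R2)
  (f_bounds : forall x a, boundary Omega x ->
     all_unit_tangents (boundary Omega) a -> F1 <= f x a <= F2) :
  let u := surface_value (boundary Omega) f r Tgt g in
  let v := extended_value (boundary Omega) (tube Omega eps)
             (fun z => Btensor (t z) (sigma z) (nu z) mu) f r Tgt g in
  forall z, tube Omega eps z -> v z = u (closest_point (boundary Omega) z).
Proof.
move=> u v z Tz.
have n_gt0 : (0 < n)%N by case: n23 => ->.
have G_neq0 : boundary Omega !=set0.
  by have [x0 Tx0 _] := g_min; exists x0; exact: Tgt_sub.
(* The reach is a supremum, so some rho above eps already has the unique projection property. *)
have unique z' : dist_to (boundary Omega) z' < eps ->
    exists! y, nearest (boundary Omega) z' y.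
  have [_ [rho [_ rhoP] <-]] := ereal_sup_gt eps_reach.
  by rewrite lte_fin => eps_rho z'eps; apply/rhoP/(lt_trans z'eps).
by apply: (@extended_value_surface_value _ _ n_gt0 _ eps _ _ _ _ _ _ nu t kappa sigma).
Qed.
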